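(* Let $K/k$ be a separable field extension of degree $6$ and $\widetilde{K}/k$ its Galois closure. Assume $\operatorname{Gal}(\widetilde{K}/k)=F_{18}:2$ and let $F$ be a field with $K\subseteq F\subseteq\widetilde{K}$. If $[F:k]=18$, then $F/k$ is almost classically Galois. If $[F:k]=12$, then $F/k$ is Hopf Galois but not almost classically Galois.
   Context: $F_{18}:2$ denotes the transitive permutation group $6T9$ of degree $6$ and order $36$; abstractly it is isomorphic to $S_3\times S_3$. The Galois group $G=\operatorname{Gal}(\widetilde{K}/k)$ is viewed as a transitive permutation group of degree $6$ via left translation on $G/\operatorname{Gal}(\widetilde{K}/K)$. A finite extension of fields $L/k$ is called Hopf Galois if there exists a finite cocommutative $k$-Hopf algebra $H$ such that $L$ is an $H$-module algebra and the $k$-linear map $j: L\otimes_k H\to \operatorname{End}_k(L)$, $j(s\otimes h)(t)=s(ht)$ for $h\in H$, $s,t\in L$, is bijective. Let $L/k$ be a finite separable extension with Galois closure $\widetilde{L}/k$, $\Gamma=\operatorname{Gal}(\widetilde{L}/k)$, $\Gamma'=\operatorname{Gal}(\widetilde{L}/L)$, and let $\lambda:\Gamma\to\operatorname{Sym}(\Gamma/\Gamma')$ be the left translation action on left cosets. $L/k$ is called almost classically Galois if there is a regular (i.e. sharply transitive) subgroup $N$ of $\operatorname{Sym}(\Gamma/\Gamma')$ which is normalized by $\lambda(\Gamma)$ and contained in $\lambda(\Gamma)$; equivalently, $\Gamma'$ has a normal complement in $\Gamma$. *)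

(* Defs.v *)
From HB Require Import structures.
From mathcomp Require Import all_boot all_order all_algebra.
From mathcomp Require Import all_fingroup all_solvable all_field.

Set Implicit Arguments.
Unset Strict Implicit.
Unset Printing Implicit Defensive.

Import GRing.Theory.
Local Open Scope ring_scope.

(* The tensor product of two finite-dimensional vector spaces, modelled as    *)
(* the space of coordinate matrices on the bases (e_i) = vbasis {:U} and      *)
(* (f_j) = vbasis {:V}: the matrix t stands for \sum_ij t i j (e_i (x) f_j).  *)
(* The lemmas tens_lift_pure and tens_ext are its universal property.         *)
Section Tensor.
Variable k : fieldType.

Definition tens (U V : vectType k) : vectType k :=
  'M[k]_(\dim {:U}, \dim {:V}).

Definition pure (U V : vectType k) (u : U) (v : V) : tens U V :=
  \matrix_(i, j) (coord (vbasis {:U}) i u * coord (vbasis {:V}) j v).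

(* The map U (x) V -> W induced by a bilinear map b. In Sweedler notation,    *)
(* tens_lift b (Delta h) is \sum b h_(1) h_(2).                               *)
Definition tens_lift (U V : vectType k) (W : lmodType k) (b : U -> V -> W)
    (t : tens U V) : W :=
  \sum_i \sum_j (t : 'M[k]_(_, _)) i j *: b (vbasis {:U})`_i (vbasis {:V})`_j.

Lemma tens_lift_pure (U V : vectType k) (W : lmodType k) (b : U -> V -> W)
    (blinl : forall v, linear (b^~ v)) (blinr : forall u, linear (b u))
    (u : U) (v : V) :
  tens_lift b (pure u v) = b u v.
Proof.
pose bl w := GRing.isLinear.Build k U W _ (b^~ w) (blinl w).
pose fl w : {linear U -> W} := HB.pack (b^~ w) (bl w).
pose br w := GRing.isLinear.Build k V W _ (b w) (blinr w).
pose fr w : {linear V -> W} := HB.pack (b w) (br w).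
rewrite {2}(coord_vbasis (memvf u)) -[b _ v]/(fl v _) linear_sum.
apply: eq_bigr => i _; rewrite linearZ /=.
rewrite {2}(coord_vbasis (memvf v)) -[b _ _]/(fr _ _) linear_sum scaler_sumr.
by apply: eq_bigr => j _; rewrite linearZ /= scalerA mxE.
Qed.

Lemma tens_ext (U V : vectType k) (W : lmodType k)
    (f g : {linear tens U V -> W}) :
  (forall u v, f (pure u v) = g (pure u v)) -> f =1 g.
Proof.
move=> fg t; rewrite [t](matrix_sum_delta (t : 'M_(_, _))) !linear_sum.
apply: eq_bigr => i _; rewrite !linear_sum; apply: eq_bigr => j _.
rewrite !linearZ /=; congr (_ *: _).
suff -> : delta_mx i j = pure (vbasis {:U})`_i (vbasis {:V})`_j by exact: fg.
apply/matrixP=> i' j'; rewrite !mxE !coord_free ?(basis_free (vbasisP _)) //.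
by rewrite -natrM mulnb (eq_sym i) (eq_sym j).
Qed.

End Tensor.

(* Finite-dimensional Hopf algebras over k; the underlying unital associative *)
(* algebra is an falgType, which is nonzero, as a Hopf algebra is by          *)
(* counit 1 = 1.                                                              *)
Record hopf_algebra (k : fieldType) := HopfAlgebra {
  hopf_sort :> falgType k;
  comul : {linear hopf_sort -> tens hopf_sort hopf_sort};
  counit : {scalar hopf_sort};
  antipode : {linear hopf_sort -> hopf_sort};
  comulA : forall h,
    tens_lift (fun a b => tens_lift (fun a1 a2 => pure a1 (pure a2 b))
                                    (comul a)) (comul h)
    = tens_lift (fun a b => pure a (comul b)) (comul h);
  counitl : forall h, tens_lift (fun a b => counit a *: b) (comul h) = h;
  counitr : forall h, tens_lift (fun a b => counit b *: a) (comul h) = h;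
  comul1 : comul 1 = pure 1 1;
  comulM : forall a b,
    comul (a * b)
    = tens_lift (fun a1 a2 => tens_lift (fun b1 b2 => pure (a1 * b1) (a2 * b2))
                                        (comul b)) (comul a);
  counit1 : counit 1 = 1;
  counitM : forall a b, counit (a * b) = counit a * counit b;
  antipodel : forall h,
    tens_lift (fun a b => antipode a * b) (comul h) = (counit h)%:A;
  antipoder : forall h,
    tens_lift (fun a b => a * antipode b) (comul h) = (counit h)%:A
}.

Arguments comul {k H} : rename.
Arguments counit {k H} : rename.
Arguments antipode {k H} : rename.

Definition cocommutative (k : fieldType) (H : hopf_algebra k) : Prop :=
  forall h : H, tens_lift (fun a b => pure b a) (comul h) = comul h.

Definition module_algebra (k : fieldType) (H : hopf_algebra k)
    (L : fieldExtType k) (act : {linear H -> 'End(L)}) : Prop :=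
  [/\ act 1 = \1%VF,
      forall g h : H, act (g * h) = (act g \o act h)%VF,
      forall h : H, act h 1 = (counit h)%:A &
      forall (h : H) (s t : L),
        act h (s * t) = tens_lift (fun a b => act a s * act b t) (comul h)].

Definition hopf_galois_map (k : fieldType) (H : hopf_algebra k)
    (L : fieldExtType k) (act : {linear H -> 'End(L)}) : tens L H -> 'End(L) :=
  tens_lift (fun (s : L) (h : H) => (amull s \o act h)%VF).

Definition hopf_galois (k : fieldType) (L : fieldExtType k) : Prop :=
  exists (H : hopf_algebra k) (act : {linear H -> 'End(L)}),
    [/\ cocommutative H, module_algebra act & bijective (hopf_galois_map act)].

Definition regular_perm_group (S : finType) (N : {group {perm S}}) : Prop :=
  [transitive N, on [set: S] | 'P] /\ forall x : S, ('C_N[x | 'P] = 1)%g.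

(* Base field k = 1%VS; all fields live in an ambient extension M of k.       *)
Definition galois_closure (k : fieldType) (M : splittingFieldType k)
    (L E : {subfield M}) : Prop :=
  [/\ (L <= E)%VS, galois 1%VS E &
      forall E' : {subfield M}, (L <= E')%VS -> galois 1%VS E' -> (E <= E')%VS].

(* MathComp composes automorphisms from left to right, (x * y) a = y (x a).   *)
(* So with respect to composition of maps, the left coset g \o G' is the set  *)
(* G' :* g, and left translation by s, which sends it to (s \o g) \o G', is   *)
(* the right translation 'Rs, which sends G' :* g to G' :* (g * s).           *)
Section CosetAction.
Variables (k : fieldType) (M : splittingFieldType k) (E L : {subfield M}).

Definition gal_cosets :=
  {X : {set gal_of E} | X \in rcosets 'Gal(E / L) 'Gal(E / 1)}.

Definition gal_lambda : {set {perm gal_cosets}} :=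
  (actperm ('Rs^?)%act @* 'Gal(E / 1))%g.

Definition has_regular_normalized_subgroup : Prop :=
  exists N : {group {perm gal_cosets}},
    [/\ N \subset gal_lambda, regular_perm_group N &
        gal_lambda \subset 'N(N)%g].

End CosetAction.

Definition almost_classically_galois (k : fieldType) (M : splittingFieldType k)
    (L : {subfield M}) : Prop :=
  exists2 E : {subfield M},
    galois_closure L E & has_regular_normalized_subgroup E L.

Definition perm_isomorphic (S T : finType)
    (A : {set {perm S}}) (B : {set {perm T}}) : Prop :=
  exists2 f : S -> T, bijective f &
    forall s : {perm S},
      s \in A <-> exists2 t, t \in B & forall x, f (s x) = t (f x).

(* 6T9 = <(2 4 6), (1 5)(2 4), (1 4)(2 5)(3 6)>, on the points 1, ..., 6      *)
(* renumbered 0, ..., 5.                                                      *)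
Definition transp6 (i j : nat) : 'S_6 := tperm (inord i) (inord j).

Definition F18_2 : {set 'S_6} :=
  <<[set transp6 1 3 * transp6 1 5;
         transp6 0 4 * transp6 1 3;
         transp6 0 3 * transp6 1 4 * transp6 2 5]>>%g.

(* Main.v *)
Require Import Defs.
From HB Require Import structures.
From mathcomp Require Import all_boot all_order all_algebra.
From mathcomp Require Import all_fingroup all_solvable all_field.

(* Let G = Gal(Kt/k), D = Gal(Kt/K) and Q = Gal(Kt/F), a subgroup of D. On    *)
(* the six points, 6T9 has a regular normal subgroup isomorphic to S_3, which *)
(* gives S normal in G with S :&: D = 1 and G = S * D. If [F : k] = 18, then  *)
(* Q has order 2 and S * A, with A of order 3 in D, is a normal complement of *)
(* Q. If [F : k] = 12, then Q has order 3; a regular subgroup of lambda(G)    *)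
(* normalised by lambda(G) would be a normal subgroup of index 3, but G is    *)
(* generated by involutions. Still, with B of order 2 in D, the group S x B,  *)
(* where S acts on G / Q by left translations and B by right ones, is regular *)
(* and normalised by lambda(G), and descent of its group algebra Kt[S x B]    *)
(* along Kt/k yields the Hopf algebra (Greither-Pareigis).                    *)

Set Implicit Arguments.
Unset Strict Implicit.
Unset Printing Implicit Defensive.

Import GRing.Theory.

Local Open Scope ring_scope.

(** * Hopf algebras with a group-like basis over an extension *)

(** Let G, D and Q be the Galois groups of [Kt] over k, K and F. Since [Kt] is the closure of K, no
    nontrivial normal subgroup of G lies in D ([galois_closure_core]). So G acts faithfully on the
    cosets of D and of Q, and computations in [F18_2] give facts about G ([coset_F18_2]): |G| = 36,
    |D| = 6, some normal S of order 6 meets D trivially, and no normal subgroup has index 3.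

    A normal complement of Q acts regularly on the cosets of Q ([regular_normal_complement]);
    conversely, a regular subgroup of the translations that they normalise pulls back to a normal
    subgroup of index |Q| ([regular_normal_preimage]). In degree 18, |Q| = 2 and S together with the
    subgroup of order 3 of D is such a complement. In degree 12, |Q| = 3 and the index is
    impossible.

    The Hopf algebra in degree 12 consists of the G-invariants of the group algebra Kt[N], where N =
    S x B acts simply transitively on the embeddings of F in [Kt] and is normalised by G
    ([split_hopf_galois]). The invariants are the equivariant families N -> Kt; Speiser's lemma
    shows that they form a k-form of Kt[N], and the Hopf structure with N group-like descends to
    them ([form_hopf], [descent_hopf_galois]). Independence of the embeddings makes the Galois map
    injective, and equal dimensions make it bijective ([form_hopf_galois]). *)

Section TensorLift.
Variables (k : fieldType) (U V : vectType k).

Fact tens_lift_is_linear (W : lmodType k) (b : U -> V -> W) :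
  linear (tens_lift b).
Proof.
move=> a s t; rewrite /tens_lift scaler_sumr -big_split; apply: eq_bigr => i _.
rewrite scaler_sumr -big_split; apply: eq_bigr => j _.
by rewrite /= !mxE scalerDl scalerA.
Qed.

HB.instance Definition _ (W : lmodType k) (b : U -> V -> W) :=
  GRing.isLinear.Build k (tens U V) W _ (tens_lift b) (tens_lift_is_linear b).

Lemma eq_tens_lift (W : lmodType k) (b b' : U -> V -> W) t :
  (forall u v, b u v = b' u v) -> tens_lift b t = tens_lift b' t.
Proof.
by move=> bb; apply: eq_bigr => i _; apply: eq_bigr => j _; rewrite bb.
Qed.

Lemma linear_tens_lift (W W' : lmodType k) (f : {linear W -> W'})
    (b : U -> V -> W) t :
  f (tens_lift b t) = tens_lift (fun u v => f (b u v)) t.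
Proof.
rewrite linear_sum; apply: eq_bigr => i _; rewrite linear_sum.
by apply: eq_bigr => j _; rewrite linearZ.
Qed.

Lemma tens_lift_sum (W : lmodType k) (I : finType) (b : I -> U -> V -> W) t :
  tens_lift (fun u v => \sum_i b i u v) t = \sum_i tens_lift (b i) t.
Proof.
rewrite [RHS]exchange_big; apply: eq_bigr => i _ /=.
by rewrite exchange_big; apply: eq_bigr => j _; rewrite scaler_sumr.
Qed.

Variable E : fieldExtType k.

Lemma tens_liftMl (a : E) (b : U -> V -> E) t :
  tens_lift (fun u v => a * b u v) t = a * tens_lift b t.
Proof.
rewrite mulr_sumr; apply: eq_bigr => i _; rewrite mulr_sumr.
by apply: eq_bigr => j _; rewrite scalerAr.
Qed.

Lemma tens_liftMr (a : E) (b : U -> V -> E) t :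
  tens_lift (fun u v => b u v * a) t = tens_lift b t * a.
Proof.
by rewrite mulrC -tens_liftMl; apply: eq_tens_lift => u v; rewrite mulrC.
Qed.

Lemma tens_lift_pureM (f : {linear U -> E}) (g : {linear V -> E}) u v :
  tens_lift (fun u v => f u * g v) (pure u v) = f u * g v.
Proof.
rewrite (@tens_lift_pure _ _ _ _ (fun u v => f u * g v)) // => w a x y.
  by rewrite /= linearP mulrDl scalerAl.
by rewrite /= linearP mulrDr scalerAr.
Qed.

(** Write [t] as a sum of b_m (x) v_m along the basis of [U]. For fixed [j] the values of [g j] at
    the v_m are the coefficients of a relation tested by every [f i], hence vanish; then [g] forces
    each v_m to be 0. *)
Lemma tens_sep (I J : Type) (f : I -> {linear U -> E})
    (g : J -> {linear V -> E})
    (t : tens U V) :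
  (forall a : 'I_(\dim {:U}) -> E,
     (forall i, \sum_m a m * f i (vbasis {:U})`_m = 0) -> forall m, a m = 0) ->
  (forall v, (forall j, g j v = 0) -> v = 0) ->
  (forall i j, tens_lift (fun u v => f i u * g j v) t = 0) -> t = 0.
Proof.
move=> f_free g_sep fgt0; apply/matrixP => m n; rewrite mxE.
pose v m := \sum_n (t : 'M_(_, _)) m n *: (vbasis {:V})`_n.
suff v0 : v m = 0.
  by move/freeP: (basis_free (vbasisP {:V})) => /(_ _ v0 n).
apply: g_sep => j; apply: (f_free (fun m => g j (v m))) => i.
rewrite -[RHS](fgt0 i j) /tens_lift; apply: eq_bigr => m' _.
rewrite linear_sum mulr_suml.
by apply: eq_bigr => n' _; rewrite linearZ /= -scalerAl mulrC.
Qed.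

End TensorLift.

Section ScalarPart.
Variables (k : fieldType) (E : fieldExtType k).

(* Only meaningful on the line 1%VS, but linear on the whole of E. *)
Definition scalar_part : E -> k := coord [tuple (1 : E)] ord0.

Fact scalar_part_is_scalar : scalar scalar_part.
Proof. by move=> a x y; rewrite /scalar_part linearP. Qed.

HB.instance Definition _ :=
  GRing.isLinear.Build k E k _ scalar_part scalar_part_is_scalar.

Lemma scalar_partK x : x \in 1%VS -> (scalar_part x)%:A = x.
Proof.
move=> x1; have x1' : x \in span [tuple (1 : E)] by rewrite span_seq1.
by rewrite [RHS](coord_span x1') big_ord1.
Qed.

End ScalarPart.

(** Shortest-relation argument: subtracting e_i(x) times the relation at y from the relation at x *
    y kills the coefficient at i. By induction every other nonzero coefficient belongs to a map
    equal to e_i, so only i survives, and evaluation at 1 concludes. *)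
Lemma dedekind_independence (R : nzRingType) (F : fieldType) (I : finType)
    (e : I -> {rmorphism R -> F}) (a : I -> F) :
  (forall i j, e i =1 e j -> i = j) ->
  (forall x, \sum_i a i * e i x = 0) -> forall i, a i = 0.
Proof.
move=> e_inj; have [m] := ubnP #|[pred i | a i != 0]|.
elim: m a => // m IHm a le_m a0 i; apply/eqP/idPn => ai.
have a1 j : a j != 0 -> j = i.
  move=> aj; apply: e_inj => x; apply/eqP; rewrite -subr_eq0.
  pose b l := a l * (e l x - e i x).
  have : b j = 0.
    apply: (IHm b) => [|y]; last first.
      transitivity (\sum_l a l * e l (x * y) - e i x * \sum_l a l * e l y).
        rewrite mulr_sumr -sumrB; apply: eq_bigr => l _.
        by rewrite rmorphM /b mulrBr mulrBl -!mulrA (mulrCA (e i x)).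
      by rewrite !a0 mulr0 subr0.
    rewrite -ltnS (leq_trans _ le_m) // ltnS; apply/proper_card/properP.
    split; last by exists i; rewrite inE //= /b subrr mulr0 eqxx.
    by apply/subsetP => l; rewrite !inE /b mulf_eq0 negb_or => /andP[].
  by move/eqP; rewrite /b mulf_eq0 (negPf aj).
move: (a0 1); rewrite (bigD1 i) //= big1 => [|j /eqP ij]; last first.
  by have [->|/a1/ij []] := eqVneq (a j) 0; rewrite mul0r.
by rewrite addr0 rmorph1 mulr1 => /eqP; rewrite (negPf ai).
Qed.

(* The maps c and d present H as a form of the group algebra of N over E:     *)
(* c n h is the coefficient of h at n, and conversely n = \sum_i d n i b_i in *)
(* E (x) H, where (b_i) is the basis of H. All identities in H, H (x) H and   *)
(* H (x) H (x) H are checked on coefficients.                                 *)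
Section HopfForm.
Variables (k : fieldType) (E : fieldExtType k) (N : finGroupType).
Variables (H : falgType k) (c : N -> {linear H -> E}).
Variable d : N -> 'I_(\dim {:H}) -> E.

Hypothesis c1 : forall n, c n 1 = (n == 1%g)%:R.
Hypothesis cM : forall n a b, c n (a * b) = \sum_m c m a * c (m^-1 * n)%g b.
Hypothesis dual_N : forall n m,
  \sum_i d n i * c m (vbasis {:H})`_i = (n == m)%:R.
Hypothesis dual_H : forall i j : 'I_(\dim {:H}),
  \sum_n c n (vbasis {:H})`_i * d n j = (i == j)%:R.
Hypothesis comul_rat : forall h i j,
  \sum_n c n h * (d n i * d n j) \in 1%VS.
Hypothesis antipode_rat : forall h i, \sum_n c n^-1%g h * d n i \in 1%VS.
Hypothesis counit_rat : forall h, \sum_n c n h \in 1%VS.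

(** The elements n of [N] are made group-like: n goes to n (x) n, to 1 under the counit and to its
    inverse under the antipode. By [comul_rat], [antipode_rat] and [counit_rat] the resulting
    coordinates lie in k, where [scalar_part] is faithful. *)
Definition form_comul (h : H) : tens H H :=
  \matrix_(i, j) scalar_part (\sum_n c n h * (d n i * d n j)).
Definition form_antipode (h : H) : H :=
  \sum_i scalar_part (\sum_n c n^-1%g h * d n i) *: (vbasis {:H})`_i.
Definition form_counit (h : H) : k := scalar_part (\sum_n c n h).

Fact form_comul_linear : linear form_comul.
Proof.
move=> a x y; apply/matrixP => i j; rewrite !mxE -linearP.
congr (scalar_part _).
rewrite scaler_sumr -big_split; apply: eq_bigr => n _.
by rewrite /= linearP mulrDl scalerAl.
Qed.

Fact form_antipode_linear : linear form_antipode.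
Proof.
move=> a x y; rewrite scaler_sumr -big_split; apply: eq_bigr => i _ /=.
rewrite scalerA -scalerDl; congr (_ *: _); rewrite -linearP.
congr (scalar_part _); rewrite scaler_sumr -big_split; apply: eq_bigr => n _.
by rewrite /= linearP mulrDl scalerAl.
Qed.

Fact form_counit_linear : scalar form_counit.
Proof.
move=> a x y; rewrite -linearP; congr (scalar_part _).
by rewrite scaler_sumr -big_split; apply: eq_bigr => n _; rewrite /= linearP.
Qed.

HB.instance Definition _ :=
  GRing.isLinear.Build k H (tens H H) _ form_comul form_comul_linear.
HB.instance Definition _ :=
  GRing.isLinear.Build k H H _ form_antipode form_antipode_linear.
HB.instance Definition _ :=
  GRing.isLinear.Build k H k _ form_counit form_counit_linear.

(** Independence over [E], not merely over k: by [dual_H], [d] is a right inverse of the matrix of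
    the c_n(b_i). *)
Lemma form_free (a : 'I_(\dim {:H}) -> E) :
  (forall n, \sum_i a i * c n (vbasis {:H})`_i = 0) -> forall i, a i = 0.
Proof.
move=> a0 j; transitivity (\sum_n (\sum_i a i * c n (vbasis {:H})`_i) * d n j).
  transitivity (\sum_i a i * (i == j)%:R).
    rewrite (bigD1 j) //= eqxx mulr1 big1 ?addr0 // => i /negPf->.
    by rewrite mulr0.
  rewrite (eq_bigr _ (fun n _ => mulr_suml _ _ _ _)) exchange_big.
  apply: eq_bigr => i _; rewrite -dual_H mulr_sumr.
  by apply: eq_bigr => n _; rewrite mulrA.
by rewrite big1 // => n _; rewrite a0 mul0r.
Qed.

Lemma form_sep (h : H) : (forall n, c n h = 0) -> h = 0.
Proof.
move=> ch0; rewrite (coord_vbasis (memvf h)) big1 // => i _.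
suff : (coord (vbasis {:H}) i h)%:A = 0 :> E.
  by move/eqP; rewrite scaler_eq0 oner_eq0 orbF => /eqP->; rewrite scale0r.
apply: (form_free (a := fun i => (coord (vbasis {:H}) i h)%:A)) => n.
rewrite -[RHS](ch0 n) {2}(coord_vbasis (memvf h)) linear_sum.
by apply: eq_bigr => j _; rewrite linearZ /= mulr_algl.
Qed.

Lemma form_eq (g h : H) : (forall n, c n g = c n h) -> g = h.
Proof.
move=> cgh; apply/eqP; rewrite -subr_eq0; apply/eqP/form_sep => n.
by rewrite linearB /= cgh subrr.
Qed.

Definition form_c2 m n : tens H H -> E :=
  tens_lift (fun a b => c m a * c n b).
HB.instance Definition _ m n := GRing.Linear.on (form_c2 m n).

Lemma form_eq2 (s t : tens H H) :
  (forall m n, form_c2 m n s = form_c2 m n t) -> s = t.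
Proof.
move=> cst; apply/eqP; rewrite -subr_eq0; apply/eqP.
apply: (tens_sep (f := c) (g := c)) => [a||m n]; first exact: form_free.
  exact: form_sep.
by rewrite -/(form_c2 m n _) linearB /= cst subrr.
Qed.

Lemma form_eq3 (s t : tens H (tens H H)) :
  (forall l m n, tens_lift (fun a b => c l a * form_c2 m n b) s
               = tens_lift (fun a b => c l a * form_c2 m n b) t) -> s = t.
Proof.
move=> cst; apply/eqP; rewrite -subr_eq0; apply/eqP.
apply: (tens_sep (f := c)
  (g := fun p => form_c2 p.1 p.2 : {linear tens H H -> E})) => [a|t' t0|l p].
- exact: form_free.
- apply: form_eq2 => m n; rewrite linear0; exact: (t0 (m, n)).
- by rewrite linearB /= cst subrr.
Qed.

(** Group-likeness read on coefficients; the coalgebra axioms below reduce to it. *)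
Lemma c2_comul m n h : form_c2 m n (form_comul h) = (m == n)%:R * c n h.
Proof.
transitivity (\sum_l c l h * ((l == m)%:R * (l == n)%:R)).
  transitivity (\sum_i \sum_j \sum_l c l h *
     ((d l i * c m (vbasis {:H})`_i) * (d l j * c n (vbasis {:H})`_j))).
    apply: eq_bigr => i _; apply: eq_bigr => j _.
    rewrite mxE -mulr_algl scalar_partK // mulr_suml; apply: eq_bigr => l _.
    rewrite -!mulrA; congr (_ * _); rewrite !mulrA; congr (_ * _).
    by rewrite mulrAC.
  under eq_bigr do rewrite exchange_big /=; rewrite exchange_big /=.
  apply: eq_bigr => l _; rewrite -!dual_N mulr_suml mulr_sumr.
  by apply: eq_bigr => i _; rewrite !mulr_sumr.
rewrite (bigD1 n) //= eqxx mulr1 big1 => [|l /negPf->].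
  by rewrite addr0 mulrC eq_sym.
by rewrite !mulr0.
Qed.

Lemma c_antipode n h : c n (form_antipode h) = c n^-1%g h.
Proof.
rewrite linear_sum /=.
transitivity (\sum_m c m^-1%g h * (m == n)%:R).
  under eq_bigr do rewrite linearZ /= -mulr_algl scalar_partK // mulr_suml.
  rewrite exchange_big; apply: eq_bigr => m _; rewrite -dual_N mulr_sumr.
  by apply: eq_bigr => i _; rewrite mulrA.
rewrite (bigD1 n) //= eqxx mulr1 big1 ?addr0 // => l /negPf->.
by rewrite mulr0.
Qed.

Lemma counitE h : (form_counit h)%:A = \sum_n c n h.
Proof. exact: scalar_partK. Qed.

Lemma c2_pure m n a b : form_c2 m n (pure a b) = c m a * c n b.
Proof. exact: tens_lift_pureM. Qed.

Fact form_comulA h :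
  tens_lift (fun a b => tens_lift (fun a1 a2 => pure a1 (pure a2 b))
                                  (form_comul a)) (form_comul h)
  = tens_lift (fun a b => pure a (form_comul b)) (form_comul h).
Proof.
apply: form_eq3 => l m n; rewrite !linear_tens_lift.
transitivity ((l == m)%:R * ((m == n)%:R * c n h)).
  rewrite -c2_comul -tens_liftMl; apply: eq_tens_lift => a b.
  rewrite linear_tens_lift mulrA -c2_comul -tens_liftMr.
  apply: eq_tens_lift => a1 a2.
  by rewrite /= tens_lift_pureM /= c2_pure mulrA.
transitivity ((m == n)%:R * ((l == n)%:R * c n h)).
  by have [->|_] := eqVneq m n; rewrite ?mul1r // !mul0r mulr0.
rewrite -c2_comul -tens_liftMl; apply: eq_tens_lift => a b.
by rewrite /= tens_lift_pureM /= c2_comul mulrCA.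
Qed.

Fact form_counitl h :
  tens_lift (fun a b => form_counit a *: b) (form_comul h) = h.
Proof.
apply: form_eq => n; rewrite linear_tens_lift.
transitivity (tens_lift (fun a b => \sum_m c m a * c n b) (form_comul h)).
  apply: eq_tens_lift => a b.
  by rewrite linearZ /= -mulr_algl counitE mulr_suml.
rewrite tens_lift_sum (bigD1 n) //= [tens_lift _ _]c2_comul eqxx mul1r.
by rewrite big1 ?addr0 // => m /negPf mn; rewrite [LHS]c2_comul mn mul0r.
Qed.

Fact form_cocomm h :
  tens_lift (fun a b => pure b a) (form_comul h) = form_comul h.
Proof.
apply: form_eq2 => m n; rewrite linear_tens_lift c2_comul.
transitivity (form_c2 n m (form_comul h)).
  by apply: eq_tens_lift => a b; rewrite /= c2_pure mulrC.
rewrite c2_comul eq_sym; have [->//|_] := eqVneq m n.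
by rewrite !mul0r.
Qed.

Fact form_counitr h :
  tens_lift (fun a b => form_counit b *: a) (form_comul h) = h.
Proof.
apply: form_eq => n; rewrite linear_tens_lift.
transitivity (tens_lift (fun a b => \sum_m c n a * c m b) (form_comul h)).
  apply: eq_tens_lift => a b.
  by rewrite linearZ /= -mulr_algl counitE mulrC mulr_sumr.
rewrite tens_lift_sum (bigD1 n) //= [tens_lift _ _]c2_comul eqxx mul1r.
rewrite big1 ?addr0 // => m mn.
by rewrite [LHS]c2_comul eq_sym (negPf mn) mul0r.
Qed.

Fact form_comul1 : form_comul 1 = pure 1 1.
Proof.
apply: form_eq2 => m n; rewrite c2_comul c2_pure !c1.
have [->|] := eqVneq m n; first by rewrite mul1r -natrM mulnb andbb.
move=> mn; rewrite mul0r -natrM mulnb; case: (eqVneq m 1%g) mn => //= ->.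
by rewrite eq_sym => /negPf->.
Qed.

Fact form_comulM a b :
  form_comul (a * b)
  = tens_lift (fun a1 a2 => tens_lift (fun b1 b2 => pure (a1 * b1) (a2 * b2))
                                      (form_comul b)) (form_comul a).
Proof.
apply: form_eq2 => m n; rewrite c2_comul cM linear_tens_lift.
transitivity (\sum_i \sum_j form_c2 i j (form_comul a)
                * form_c2 (i^-1 * m)%g (j^-1 * n)%g (form_comul b)).
  rewrite mulr_sumr; apply: eq_bigr => i _.
  rewrite (bigD1 i) //= big1 => [|j ji]; last first.
    by rewrite c2_comul eq_sym (negPf ji) !mul0r.
  by rewrite !c2_comul eqxx mul1r addr0 (inj_eq (mulgI _)) mulrCA.
rewrite [RHS](@eq_tens_lift _ _ _ _ _ (fun a1 a2 => \sum_i \sum_j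
  c i a1 * c j a2 * form_c2 (i^-1 * m)%g (j^-1 * n)%g (form_comul b))).
  rewrite tens_lift_sum; apply: eq_bigr => i _; rewrite tens_lift_sum.
  by apply: eq_bigr => j _; rewrite tens_liftMr.
move=> a1 a2; rewrite linear_tens_lift.
under [RHS]eq_bigr => i _ do under eq_bigr => j _ do rewrite -tens_liftMl.
under [RHS]eq_bigr => i _ do rewrite -tens_lift_sum.
rewrite -tens_lift_sum; apply: eq_tens_lift => b1 b2.
rewrite /= c2_pure !cM mulr_suml; apply: eq_bigr => i _.
by rewrite mulr_sumr; apply: eq_bigr => j _; rewrite mulrACA.
Qed.

Fact form_counit1 : form_counit 1 = 1.
Proof.
apply: (@fmorph_inj _ _ (in_alg E)); rewrite /= counitE scale1r.
by rewrite (bigD1 1%g) //= c1 eqxx big1 ?addr0 // => n /negPf; rewrite c1 => ->.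
Qed.

Fact form_counitM a b : form_counit (a * b) = form_counit a * form_counit b.
Proof.
apply: (@fmorph_inj _ _ (in_alg E)); rewrite rmorphM /= !counitE mulr_suml.
under eq_bigr do rewrite cM; rewrite exchange_big; apply: eq_bigr => m _.
by rewrite -mulr_sumr [in RHS](reindex_inj (mulgI m^-1%g)).
Qed.

Fact form_antipodel h :
  tens_lift (fun a b => form_antipode a * b) (form_comul h)
  = (form_counit h)%:A.
Proof.
apply: form_eq => n; rewrite linear_tens_lift linearZ /= c1 -mulr_algl counitE.
transitivity (\sum_m form_c2 m^-1%g (m^-1 * n)%g (form_comul h)).
  rewrite -tens_lift_sum; apply: eq_tens_lift => a b; rewrite cM.
  by apply: eq_bigr => m _; rewrite c_antipode.
rewrite mulr_suml (reindex_inj invg_inj); apply: eq_bigr => m _.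
rewrite c2_comul invgK -{1}[m]mulg1 (inj_eq (mulgI _)) eq_sym mulrC.
by have [->|_] := eqVneq n 1%g; rewrite ?mulg1 // !mulr0.
Qed.

Fact form_antipoder h :
  tens_lift (fun a b => a * form_antipode b) (form_comul h)
  = (form_counit h)%:A.
Proof.
apply: form_eq => n; rewrite linear_tens_lift linearZ /= c1 -mulr_algl counitE.
transitivity (\sum_m form_c2 m (n^-1 * m)%g (form_comul h)).
  rewrite -tens_lift_sum; apply: eq_tens_lift => a b; rewrite cM.
  by apply: eq_bigr => m _; rewrite c_antipode invMg invgK.
rewrite mulr_suml; apply: eq_bigr => m _.
rewrite c2_comul -{1}[m]mul1g (inj_eq (mulIg _)) eq_sym mulrC eq_invg1.
by have [->|_] := eqVneq n 1%g; rewrite ?invg1 ?mul1g // !mulr0.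
Qed.

Definition form_hopf : hopf_algebra k :=
  @HopfAlgebra k H form_comul form_counit form_antipode form_comulA
    form_counitl form_counitr form_comul1 form_comulM form_counit1
    form_counitM form_antipodel form_antipoder.

(** [c] and [d] give mutually inverse rectangular matrices over a field, which must be square. *)
Lemma form_dim : \dim {:H} = #|N|.
Proof.
pose X : 'M[E]_(\dim {:H}, #|N|) :=
  \matrix_(i, p) c (enum_val p) (vbasis {:H})`_i.
pose Y := \matrix_(p, j) d (enum_val p) j : 'M[E]_(#|N|, \dim {:H}).
have XY : X *m Y = 1%:M.
  apply/matrixP => i j; rewrite !mxE -dual_H.
  rewrite [RHS](reindex (@enum_val N predT)); last exact/onW_bij/enum_val_bij.
  by apply: eq_bigr => p _; rewrite !mxE.
have YX : Y *m X = 1%:M.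
  apply/matrixP => p q; rewrite !mxE -(inj_eq enum_val_inj) -dual_N.
  by apply: eq_bigr => i _; rewrite !mxE.
by apply/eqP; rewrite eqn_leq (mulmx1_min XY) (mulmx1_min YX).
Qed.

(** * Module algebra structure and bijectivity of the Galois map *)

Section Action.
Variables (L : fieldExtType k) (e : N -> {lrmorphism L -> E}).
Variable act : {linear H -> 'End(L)}.
Hypothesis e_inj : forall m n, e m =1 e n -> m = n.
Hypothesis actE : forall h n x, e n (act h x) = \sum_m c m h * e (n * m)%g x.

Lemma form_act1 h x : e 1%g (act h x) = \sum_m c m h * e m x.
Proof. by rewrite actE; apply: eq_bigr => m _; rewrite mul1g. Qed.

(** As [e 1] is injective, each identity in [L] is tested in [E], where h acts as the combination of
    the embeddings [e m] with coefficients c_m(h). *)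
Lemma form_module_algebra : module_algebra (H := form_hopf) act.
Proof.
have e1_inj : injective (e 1%g) := fmorph_inj (e 1%g).
split=> [|g h|h|h s t].
- apply/lfunP => x; apply: e1_inj; apply: (etrans (form_act1 _ _)).
  rewrite (bigD1 1%g) //= c1 eqxx mul1r big1 => [|n /negPf n1].
    by rewrite addr0 lfunE.
  by rewrite c1 n1 mul0r.
- apply/lfunP => x; apply: e1_inj; apply: (etrans (form_act1 _ _)).
  rewrite comp_lfunE; apply: (etrans _ (esym (form_act1 _ _))).
  under eq_bigr do rewrite cM mulr_suml; rewrite exchange_big.
  apply: eq_bigr => m _; rewrite actE mulr_sumr (reindex_inj (mulgI m)).
  by apply: eq_bigr => n _; rewrite mulKg mulrA.
- apply: e1_inj; apply: (etrans (form_act1 _ _)).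
  rewrite linearZ /= rmorph1 counitE.
  by apply: eq_bigr => n _; rewrite rmorph1 mulr1.
- apply: e1_inj; apply: (etrans (form_act1 _ _)); rewrite linear_tens_lift.
  transitivity (\sum_m \sum_n form_c2 m n (form_comul h) * (e m s * e n t)).
    apply: eq_bigr => m _; rewrite (bigD1 m) //= big1 => [|n nm].
      by rewrite c2_comul eqxx mul1r addr0 rmorphM.
    by rewrite c2_comul eq_sym (negPf nm) !mul0r.
  under eq_bigr => m _ do under eq_bigr => n _ do rewrite -tens_liftMr.
  under eq_bigr => m _ do rewrite -tens_lift_sum.
  rewrite -tens_lift_sum; apply: eq_tens_lift => a b.
  rewrite /= rmorphM /=.
  apply: (etrans _ (esym (congr2 _ (form_act1 _ _) (form_act1 _ _)))).
  rewrite mulr_suml; apply: eq_bigr => m _.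
  by rewrite mulr_sumr; apply: eq_bigr => n _; rewrite mulrACA.
Qed.

Lemma form_hopf_galois : #|N| = \dim {:L} -> hopf_galois L.
Proof.
move=> cardN; exists form_hopf, act; split; [exact: form_cocomm | |].
  exact: form_module_algebra.
set j := hopf_galois_map _; pose f := linfun j.
have fE t : j t = f t by rewrite lfunE.
have dim_eq : \dim {:tens L H} = \dim {:'End(L)}.
  rewrite !dimvf dim_matrix -[dim 'End(L)]/(dim L * dim L)%N.
  by rewrite form_dim cardN -dimvf.
suff f0 : lker f == 0%VS.
  exists f^-1%VF => t; rewrite fE ?lker0_lfunK // limg_lfunVK //.
  suff -> : limg f = fullv by exact: memvf.
  apply/eqP; rewrite eqEdim subvf limg_dim_eq.
    exact: eq_leq (esym dim_eq).
  by rewrite (eqP f0) capv0.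
apply/lker0P => s t fst; apply/eqP; rewrite -subr_eq0; apply/eqP.
have : f (s - t) = 0 by rewrite linearB /= fst subrr.
move: {s t fst}(s - t) => t ft0.
(* The value of [f t] at x, embedded by [e 1], is a relation between the [e m] with these
   coefficients. *)
have et0 m : tens_lift (fun s h => e 1%g s * c m h) t = 0.
  move: m; apply: (dedekind_independence e_inj) => x.
  under eq_bigr do rewrite -tens_liftMr; rewrite -tens_lift_sum.
  transitivity (e 1%g (f t x)); last by rewrite ft0 zero_lfunE rmorph0.
  rewrite -fE.
  rewrite /j /hopf_galois_map /tens_lift sum_lfunE linear_sum.
  apply: eq_bigr => i _; rewrite sum_lfunE linear_sum.
  apply: eq_bigr => l _; rewrite scale_lfunE linearZ comp_lfunE lfunE /=.
  rewrite rmorphM /=; congr (_ *: _).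
  apply: (etrans _ (esym (congr1 _ (form_act1 _ _)))).
  by rewrite mulr_sumr; apply: eq_bigr => m' _; rewrite mulrA.
(* Regrouped along the basis of [H], the vanishing just obtained is a relation of the kind excluded
   by [form_free]. *)
pose v l := \sum_i (t : 'M_(_, _)) i l *: (vbasis {:L})`_i.
have v0 l : v l = 0.
  apply: (fmorph_inj (e 1%g)); rewrite rmorph0.
  apply: (form_free (a := fun l => e 1%g (v l))) l => m.
  rewrite -[RHS](et0 m) /tens_lift exchange_big; apply: eq_bigr => l _.
  rewrite linear_sum mulr_suml; apply: eq_bigr => i _.
  by rewrite linearZ /= -scalerAl.
apply/matrixP => i l; rewrite mxE.
by move/freeP: (basis_free (vbasisP {:L})) => /(_ _ (v0 l) i).
Qed.

End Action.

End HopfForm.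

(** * Galois descent of group algebras *)

(* N acts simply transitively on the embeddings of L in E, e n being the      *)
(* image of the inclusion e 1, and e_act says that the Galois group G         *)
(* normalises this action, act being conjugation by elements of G.            *)
Section Descent.
Variables (k : fieldType) (L E : fieldExtType k) (G N : finGroupType).
Variables (sigma : G -> {lrmorphism E -> E}) (act : G -> N -> N).
Variable e : N -> {lrmorphism L -> E}.

Hypothesis sigmaM : forall g h x, sigma (g * h)%g x = sigma h (sigma g x).
Hypothesis sigma_inj : forall g h, sigma g =1 sigma h -> g = h.
Hypothesis sigma_fix : forall x, (forall g, sigma g x = x) -> x \in 1%VS.
Hypothesis act1 : forall n, act 1%g n = n.
Hypothesis actM : forall g h n, act (g * h)%g n = act h (act g n).
Hypothesis act_morph : forall g m n, act g (m * n)%g = (act g m * act g n)%g.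
Hypothesis e_inj : forall m n, e m =1 e n -> m = n.
Hypothesis e_orbit : forall n, exists g, sigma g \o e 1%g =1 e n.
Hypothesis e_act : forall g n, sigma g \o e 1%g =1 e n ->
  forall m, sigma g \o e m =1 e (n * act g m)%g.
Hypothesis e_fix : forall y,
  (forall g, sigma g \o e 1%g =1 e 1%g -> sigma g y = y) ->
  exists x, y = e 1%g x.
Hypothesis cardN : #|N| = \dim {:L}.

Definition equivariant (a : N -> E) :=
  forall g n, sigma g (a n) = a (act g n).

Lemma act_inj g : injective (act g).
Proof.
by apply: (can_inj (g := act g^-1%g)) => n; rewrite -actM mulgV act1.
Qed.

Lemma act_1 g : act g 1%g = 1%g.
Proof. by apply: (mulgI (act g 1%g)); rewrite -act_morph !mulg1. Qed.

Lemma act_inv g n : act g n^-1%g = (act g n)^-1%g.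
Proof. by apply/eqP; rewrite eq_sym eq_invg_mul -act_morph mulgV act_1. Qed.

Lemma equivariant_sum a : equivariant a -> \sum_n a n \in 1%VS.
Proof.
move=> eqa; apply: sigma_fix => g; rewrite rmorph_sum.
by rewrite [RHS](reindex_inj (@act_inj g)); apply: eq_bigr => n _; apply: eqa.
Qed.

Lemma equivariantM a b :
  equivariant a -> equivariant b -> equivariant (fun n => a n * b n).
Proof. by move=> ea eb g n; rewrite rmorphM /= ea eb. Qed.

(** The sum over the Galois group of the conjugates of the family with value [x] at [n] and 0
    elsewhere. *)
Definition trace_family (x : E) (n m : N) := \sum_(g | act g n == m) sigma g x.

Lemma equivariant_trace x n : equivariant (trace_family x n).
Proof.
move=> h m; rewrite rmorph_sum [RHS](reindex_inj (mulIg h)) /=.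
apply: eq_big => [g | g _]; last by rewrite sigmaM.
by rewrite actM (inj_eq (@act_inj h)).
Qed.

(* Speiser's lemma: over E, equivariant families span all families. *)
Lemma trace_family_sep (v : N -> E) :
  (forall a, equivariant a -> \sum_n a n * v n = 0) -> forall n, v n = 0.
Proof.
move=> v0 n; rewrite -(act1 n).
apply: (dedekind_independence sigma_inj (a := fun g => v (act g n))) => x.
rewrite -[RHS](v0 _ (equivariant_trace x n)).
rewrite (partition_big (fun g => act g n) predT) //=; apply: eq_bigr => m _.
rewrite mulr_suml; apply: eq_bigr => g /eqP <-; exact: mulrC.
Qed.

Definition embedding_comb (a : {ffun N -> E}) : 'Hom(L, E) :=
  linfun (fun x => \sum_n a n * e n x).

Lemma embedding_combE a x : embedding_comb a x = \sum_n a n * e n x.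
Proof.
have lin : linear (fun x => \sum_n a n * e n x).
  move=> b y z; rewrite scaler_sumr -big_split; apply: eq_bigr => n _.
  by rewrite /= linearP mulrDr scalerAr.
pose f : {linear L -> E} := HB.pack (fun x => \sum_n a n * e n x)
  (GRing.isLinear.Build k L E _ (fun x => \sum_n a n * e n x) lin).
exact: (lfunE f).
Qed.

Fact embedding_comb_is_linear : linear embedding_comb.
Proof.
move=> b y z; apply/lfunP => x; rewrite !lfun_simp !embedding_combE.
rewrite scaler_sumr -big_split; apply: eq_bigr => n _.
by rewrite /= !ffunE mulrDl scalerAl.
Qed.

HB.instance Definition _ := GRing.isLinear.Build k {ffun N -> E} 'Hom(L, E) _
  embedding_comb embedding_comb_is_linear.

Lemma embedding_comb_inj : injective embedding_comb.
Proof.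
move=> a b ab; apply/ffunP => n; apply/eqP; rewrite -subr_eq0; apply/eqP.
apply: (dedekind_independence e_inj (a := fun n => a n - b n)) => x.
under eq_bigr do rewrite mulrBl; rewrite sumrB -!embedding_combE ab.
exact: subrr.
Qed.

(** A k-linear map whose kernel is the set of equivariant families, which thereby becomes a
    subspace. *)
Definition equivariance_defect (a : {ffun N -> E}) : {ffun G * N -> E} :=
  [ffun p => sigma p.1 (a p.2) - a (act p.1 p.2)].

Fact equivariance_defect_is_linear : linear equivariance_defect.
Proof.
move=> b y z; apply/ffunP => p; rewrite !ffunE linearP /=.
by rewrite scalerBr addrACA opprD.
Qed.

HB.instance Definition _ := GRing.isLinear.Build k {ffun N -> E}
  {ffun G * N -> E} _ equivariance_defect equivariance_defect_is_linear.

Definition equivariant_space := lker (linfun equivariance_defect).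

Lemma equivariant_spaceP (a : {ffun N -> E}) :
  reflect (equivariant a) (a \in equivariant_space).
Proof.
rewrite memv_ker lfunE /=; apply: (iffP eqP) => [/ffunP a0 g n|eqa].
  by apply/eqP; rewrite -subr_eq0; have := a0 (g, n); rewrite !ffunE => ->.
by apply/ffunP => p; rewrite !ffunE /= eqa subrr.
Qed.

(** Meaningful for equivariant [a]: then the combination of embeddings takes values in the image of
    [e 1], by [e_fix], and can be pulled back to [L]. *)
Definition descend (a : {ffun N -> E}) : 'End(L) :=
  ((linfun (e 1%g))^-1 \o embedding_comb a)%VF.

Fact descend_is_linear : linear descend.
Proof.
by move=> b y z; rewrite /descend linearP comp_lfunDr -comp_lfunZr.
Qed.

HB.instance Definition _ := GRing.isLinear.Build k {ffun N -> E} 'End(L) _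
  descend descend_is_linear.

Lemma descendE a x : a \in equivariant_space ->
  e 1%g (descend a x) = \sum_n a n * e n x.
Proof.
move/equivariant_spaceP => eqa; rewrite comp_lfunE -[LHS](lfunE (e 1%g)).
rewrite limg_lfunVK embedding_combE //.
have [|y ->] := @e_fix (\sum_n a n * e n x); last first.
  by rewrite -[e _ _](lfunE (e 1%g)) memv_img ?memvf.
move=> g /e_act eg; rewrite rmorph_sum [RHS](reindex_inj (@act_inj g)).
apply: eq_bigr => n _; rewrite rmorphM /= eqa; congr (_ * _).
by rewrite [LHS](eg n) mul1g.
Qed.

(** The Galois invariants of E[N], realised as endomorphisms of [L]. *)
Definition descent_space := (linfun descend @: equivariant_space)%VS.

Definition coef (n : N) (h : 'End(L)) : E :=
  ((linfun embedding_comb)^-1%VF (linfun (e 1%g) \o h)%VF : {ffun N -> E}) n.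

Fact coef_is_linear n : linear (coef n).
Proof.
by move=> a x y; rewrite /coef comp_lfunDr -comp_lfunZr linearP !ffunE.
Qed.

HB.instance Definition _ n :=
  GRing.isLinear.Build k 'End(L) E _ (coef n) (coef_is_linear n).

Lemma coef_uniq a (h : 'End(L)) :
  (forall x, e 1%g (h x) = \sum_n a n * e n x) -> forall n, coef n h = a n.
Proof.
move=> eh n; rewrite /coef.
suff -> : (linfun (e 1%g) \o h)%VF = linfun embedding_comb (finfun a).
  rewrite lker0_lfunK ?ffunE //; apply/lker0P => b c.
  by rewrite !lfunE => /embedding_comb_inj.
apply/lfunP => x; rewrite comp_lfunE !lfunE /= embedding_combE eh.
by apply: eq_bigr => m _; rewrite ffunE.
Qed.

Lemma coef_descend a n : a \in equivariant_space -> coef n (descend a) = a n.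
Proof. by move=> Wa; apply: coef_uniq => x; rewrite descendE. Qed.

Lemma descent_spaceP (h : 'End(L)) :
  reflect (exists2 a, equivariant a
             & forall x, e 1%g (h x) = \sum_n a n * e n x)
          (h \in descent_space).
Proof.
apply: (iffP memv_imgP) => [[a Wa ->]|[a eqa eh]].
  exists a; first exact/equivariant_spaceP.
  by move=> x; rewrite lfunE descendE.
have Wa : finfun a \in equivariant_space.
  by apply/equivariant_spaceP => g n; rewrite !ffunE eqa.
exists (finfun a) => //; apply/lfunP => x; apply: (fmorph_inj (e 1%g)).
rewrite lfunE /= descendE // eh.
by apply: eq_bigr => n _; rewrite ffunE.
Qed.

Lemma coefE (h : 'End(L)) x : h \in descent_space ->
  e 1%g (h x) = \sum_n coef n h * e n x.
Proof.
case/descent_spaceP => a eqa eh; rewrite eh.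
by apply: eq_bigr => n _; rewrite (coef_uniq eh).
Qed.

Lemma equivariant_coef (h : 'End(L)) :
  h \in descent_space -> equivariant (coef^~ h).
Proof.
case/descent_spaceP => a eqa eh g n.
by rewrite !(coef_uniq eh).
Qed.

(** Apply to the expansion at [e 1] a Galois element carrying [e 1] to [e n]; equivariance of the
    coefficients and [e_act] turn its effect into a reindexing of [N]. *)
Lemma coefEn (h : 'End(L)) n x : h \in descent_space ->
  e n (h x) = \sum_m coef m h * e (n * m)%g x.
Proof.
move=> Ah; have [g eg] := e_orbit n; rewrite -(eg (h x)) /= coefE //.
rewrite rmorph_sum [RHS](reindex_inj (@act_inj g)); apply: eq_bigr => m _.
rewrite rmorphM /= equivariant_coef //; congr (_ * _); exact: (e_act eg).
Qed.

Lemma coef1 n : coef n \1%VF = (n == 1%g)%:R.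
Proof.
apply: (coef_uniq (a := fun n => (n == 1%g)%:R)) => x.
rewrite lfunE (bigD1 1%g) //= eqxx mul1r big1 ?addr0 // => m /negPf->.
by rewrite mul0r.
Qed.

Lemma id_descent_space : \1%VF \in descent_space.
Proof.
apply/descent_spaceP; exists (fun n => (n == 1%g)%:R) => [g n|x].
  by rewrite rmorph_nat -{2}(act_1 g) (inj_eq (@act_inj g)).
rewrite lfunE (bigD1 1%g) //= eqxx mul1r big1 ?addr0 // => m /negPf->.
by rewrite mul0r.
Qed.

Lemma coef_comp (f g : 'End(L)) : f \in descent_space -> g \in descent_space ->
  forall x, e 1%g ((g \o f)%VF x)
    = \sum_n (\sum_m coef m g * coef (m^-1 * n)%g f) * e n x.
Proof.
move=> Af Ag x; rewrite comp_lfunE coefE //.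
under [RHS]eq_bigr do rewrite mulr_suml; rewrite exchange_big.
apply: eq_bigr => m _; rewrite coefEn // mulr_sumr [RHS](reindex_inj (mulgI m)).
by apply: eq_bigr => n _; rewrite mulKg mulrA.
Qed.

Import FalgLfun.

Fact descent_space_aspace : is_aspace descent_space.
Proof.
apply/andP; split.
  by apply: has_algid1; exact: id_descent_space.
apply/prodvP => f g Af Ag; apply/descent_spaceP.
exists (fun n => \sum_m coef m g * coef (m^-1 * n)%g f); last first.
  exact: coef_comp.
move=> s n; rewrite rmorph_sum [RHS](reindex_inj (@act_inj s)).
apply: eq_bigr => m _; rewrite rmorphM /= !equivariant_coef //.
by rewrite act_morph act_inv.
Qed.

Definition descent_aspace : {aspace 'End(L)} := ASpace descent_space_aspace.
Definition descent_algebra : falgType k := subvs_of descent_aspace.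

(* The product of FalgLfun is (f * g) x = g (f x), so coef is multiplicative  *)
(* only up to reversal; the inverse corrects this, and makes the algebra act  *)
(* on L through its antipode rather than by evaluation.                       *)
Definition group_coef (n : N) (h : descent_algebra) : E :=
  coef n^-1%g (vsval h).

Fact group_coef_is_linear n : linear (group_coef n).
Proof. by move=> a x y; rewrite /group_coef !linearP. Qed.

HB.instance Definition _ n :=
  GRing.isLinear.Build k descent_algebra E _ (group_coef n)
    (group_coef_is_linear n).

Lemma group_coef1 n : group_coef n 1 = (n == 1%g)%:R.
Proof.
rewrite /group_coef.
have -> : vsval (1 : descent_algebra) = \1%VF.
  suff : 1 \in descent_aspace by rewrite -algid_eq1 => /eqP.
  exact: id_descent_space.
by rewrite coef1 eq_invg1.
Qed.

Lemma group_coefM n a b :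
  group_coef n (a * b) = \sum_m group_coef m a * group_coef (m^-1 * n)%g b.
Proof.
have compE u v : (u : 'End(L)) * (v : 'End(L)) = (v \o u)%VF by [].
have : vsval (a * b) = (vsval a : 'End(L)) * (vsval b : 'End(L)) by [].
rewrite compE {1}/group_coef => ->.
rewrite (coef_uniq (coef_comp (subvsP a) (subvsP b))).
rewrite (reindex_inj (mulgI n^-1%g)); apply: eq_bigr => m _.
rewrite /group_coef mulrC !invMg !invgK; congr (_ * _); congr (coef _ _).
by rewrite -mulgA mulgV mulg1.
Qed.

Lemma equivariant_group_coef h : equivariant (group_coef^~ h).
Proof. by move=> g n; rewrite equivariant_coef ?(subvsP h) // act_inv. Qed.

Lemma group_coef_real a : equivariant a ->
  exists h : descent_algebra, forall n, group_coef n h = a n.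
Proof.
move=> eqa; have Wa : [ffun n => a n^-1%g] \in equivariant_space.
  by apply/equivariant_spaceP => g n; rewrite !ffunE eqa act_inv.
have Ah : descend [ffun n => a n^-1%g] \in descent_space.
  apply/descent_spaceP; exists [ffun n => a n^-1%g].
    exact/equivariant_spaceP.
  by move=> x; exact: descendE.
exists (Subvs Ah) => n; rewrite /group_coef /= coef_descend //.
by rewrite ffunE invgK.
Qed.

Lemma group_coef_inj g h : (forall n, group_coef n g = group_coef n h) -> g = h.
Proof.
move=> gh; apply/val_inj/lfunP => x.
apply: (fmorph_inj (e 1%g) : injective (e 1%g)).
rewrite (coefE _ (subvsP g)) (coefE _ (subvsP h)); apply: eq_bigr => n _.
by have := gh n^-1%g; rewrite /group_coef invgK => ->.
Qed.

Definition coef_mx : 'M[E]_(\dim {:descent_algebra}, #|N|) :=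
  \matrix_(i, p) group_coef (enum_val p) (vbasis {:descent_algebra})`_i.

Lemma sum_enum_val (F : N -> E) : \sum_(p < #|N|) F (enum_val p) = \sum_n F n.
Proof.
by rewrite [RHS](reindex (@enum_val N predT)) //; exact/onW_bij/enum_val_bij.
Qed.

(** Every equivariant family occurs as the coefficients of some element, so a vector orthogonal to
    all rows is orthogonal to all equivariant families and vanishes by Speiser's lemma. *)
Lemma coef_mx_full : row_full coef_mx.
Proof.
rewrite -col_leq_rank -mxrank_tr row_leq_rank.
apply: inj_row_free => v v0; apply/rowP => p; rewrite mxE -(enum_valK p).
apply: (trace_family_sep (v := fun n => v 0 (enum_rank n))) => a eqa.
have [h ah] := group_coef_real eqa.
transitivity (\sum_n group_coef n h * v 0 (enum_rank n)).
  by apply: eq_bigr => n _; rewrite ah.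
rewrite {1}(coord_vbasis (memvf h)).
under eq_bigr do rewrite linear_sum mulr_suml; rewrite exchange_big.
rewrite big1 // => i _; transitivity
  (coord (vbasis {:descent_algebra}) i h *: (v *m coef_mx^T) 0 i).
  rewrite mxE -sum_enum_val scaler_sumr; apply: eq_bigr => q _.
  by rewrite !mxE enum_valK linearZ /= -scalerAl mulrC.
by rewrite v0 mxE scaler0.
Qed.

(* An invertible square block of rows of coef_mx expresses each row with      *)
(* Galois-invariant coefficients, so these rows already span over k.          *)
Lemma coef_mx_dim : (\dim {:descent_algebra} <= #|N|)%N.
Proof.
pose f := fullrankfun coef_mx_full; pose C := rowsub f coef_mx.
have Cu : C \in unitmx := fullrowsub_unit coef_mx_full.
suff : ({:descent_algebra}
        <= <<[seq (vbasis {:descent_algebra})`_(f p) | p : 'I_#|N|]>>)%VS.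
  move/dimvS/leq_trans; apply; apply: leq_trans (dim_span _) _.
  by rewrite size_image card_ord.
rewrite -{1}(span_basis (vbasisP {:descent_algebra})); apply/span_subvP => h.
case/(nthP 0) => i; rewrite size_tuple => lt_i <-.
pose r := row (Ordinal lt_i) coef_mx.
have [a aC] : exists a, a *m C = r by exists (r *m invmx C); rewrite mulmxKV.
have a1 p : a 0 p \in 1%VS.
  apply: sigma_fix => g.
  suff : map_mx (sigma g) a = a by move/rowP/(_ p); rewrite mxE.
  apply: (can_inj (mulmxK Cu)); rewrite aC; apply/rowP => q.
  pose q' := enum_rank (act g^-1%g (enum_val q)).
  have eq' : enum_val q = act g (enum_val q').
    by rewrite /q' enum_rankK -actM mulVg act1.
  transitivity (sigma g (r 0 q')).
    rewrite -aC !mxE rmorph_sum; apply: eq_bigr => p' _.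
    by rewrite !mxE rmorphM /= eq' equivariant_group_coef.
  by rewrite !mxE equivariant_group_coef -eq'.
suff -> : (vbasis {:descent_algebra})`_i
   = \sum_p scalar_part (a 0 p) *: (vbasis {:descent_algebra})`_(f p).
  apply: memv_suml => p _; apply/memvZ/memv_span/mapP; exists p => //.
  by rewrite mem_enum.
apply: group_coef_inj => n; rewrite linear_sum.
transitivity (r 0 (enum_rank n)); first by rewrite !mxE enum_rankK.
rewrite -aC mxE; apply: eq_bigr => p _.
by rewrite linearZ /= -mulr_algl scalar_partK // !mxE enum_rankK.
Qed.

(** [coef_mx] is both row free and row full, but its two dimensions are not convertible; [pinvmx]
    serves as its two-sided inverse. *)
Definition dual_coef (n : N) (i : 'I_(\dim {:descent_algebra})) : E :=
  pinvmx coef_mx (enum_rank n) i.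

Lemma coef_mx_free : row_free coef_mx.
Proof.
rewrite -row_leq_rank (leq_trans coef_mx_dim) //.
by rewrite col_leq_rank coef_mx_full.
Qed.

Lemma dual_coef_N n m :
  \sum_i dual_coef n i * group_coef m (vbasis {:descent_algebra})`_i
  = (n == m)%:R.
Proof.
have /matrixP/(_ (enum_rank n) (enum_rank m)) := mulVpmx coef_mx_full.
rewrite !mxE (inj_eq enum_rank_inj) => <-; apply: eq_bigr => i _.
by rewrite /dual_coef [coef_mx _ _]mxE enum_rankK.
Qed.

Lemma dual_coef_H (i j : 'I_(\dim {:descent_algebra})) :
  \sum_n group_coef n (vbasis {:descent_algebra})`_i * dual_coef n j
  = (i == j)%:R.
Proof.
have /matrixP/(_ i j) := mulmxVp coef_mx_free.
rewrite !mxE => <-; rewrite -sum_enum_val; apply: eq_bigr => p _.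
by rewrite /dual_coef [coef_mx _ _]mxE enum_valK.
Qed.

(** The inverse of an equivariant matrix is equivariant, since the conjugated entries satisfy the
    same duality relations. *)
Lemma equivariant_dual_coef i : equivariant (dual_coef^~ i).
Proof.
move=> g n; pose b := vbasis {:descent_algebra}.
transitivity (\sum_m (\sum_j dual_coef (act g n) j * group_coef (act g m) b`_j)
                * sigma g (dual_coef m i)).
  rewrite (bigD1 n) //= dual_coef_N eqxx mul1r big1 ?addr0 // => m mn.
  by rewrite dual_coef_N (inj_eq (@act_inj g)) eq_sym (negPf mn) mul0r.
under eq_bigr do rewrite mulr_suml; rewrite exchange_big /=.
transitivity (\sum_j dual_coef (act g n) j * (j == i)%:R).
  apply: eq_bigr => j _; rewrite -(rmorph_nat (sigma g)) -dual_coef_H.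
  rewrite rmorph_sum mulr_sumr; apply: eq_bigr => m _.
  by rewrite rmorphM /= equivariant_group_coef mulrA.
rewrite (bigD1 i) //= eqxx mulr1 big1 ?addr0 // => j /negPf->.
by rewrite mulr0.
Qed.

Lemma equivariant_comul_coef h i j :
  equivariant (fun n => group_coef n h * (dual_coef n i * dual_coef n j)).
Proof.
apply: equivariantM; first exact: equivariant_group_coef.
by apply: equivariantM; apply: equivariant_dual_coef.
Qed.

Lemma equivariant_antipode_coef h i :
  equivariant (fun n => group_coef n^-1%g h * dual_coef n i).
Proof.
apply: equivariantM; last exact: equivariant_dual_coef.
by move=> g n; rewrite equivariant_group_coef act_inv.
Qed.

Theorem descent_hopf_galois : hopf_galois L.
Proof.
pose S : {linear descent_algebra -> descent_algebra} :=
  form_antipode group_coef dual_coef.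
pose hact : {linear descent_algebra -> 'End(L)} := vsval \o S.
have comul_rat h i j :
    \sum_n group_coef n h * (dual_coef n i * dual_coef n j) \in 1%VS.
  exact/equivariant_sum/equivariant_comul_coef.
have antipode_rat h i : \sum_n group_coef n^-1%g h * dual_coef n i \in 1%VS.
  exact/equivariant_sum/equivariant_antipode_coef.
have counit_rat h : \sum_n group_coef n h \in 1%VS.
  exact/equivariant_sum/equivariant_group_coef.
apply: (@form_hopf_galois k E N descent_algebra group_coef dual_coef
  group_coef1 group_coefM dual_coef_N dual_coef_H comul_rat antipode_rat
  counit_rat L e hact e_inj) => // h n x.
(* The antipode cancels the inversion built into [group_coef]. *)
rewrite coefEn ?subvsP //; apply: eq_bigr => m _; congr (_ * _).
rewrite -(invgK m); apply: etrans (c_antipode dual_coef_N antipode_rat _ _) _.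
by rewrite invgK.
Qed.

End Descent.

Local Close Scope ring_scope.
Local Open Scope group_scope.

(** * The group 6T9 *)

(** Modulo [R] the order of [x] divides both 2 and the odd index. *)
Lemma odd_index_involution (gT : finGroupType) (G R : {group gT}) x :
  R <| G -> odd #|G : R| -> x \in G -> x * x = 1 -> x \in R.
Proof.
move=> nRG oddGR Gx xx1; have Nx := subsetP (normal_norm nRG) x Gx.
apply: coset_idr => //; apply/eqP; rewrite -order_eq1 -dvdn1.
have <- : gcdn 2 #|G : R| = 1%N by apply/eqP; rewrite -/(coprime _ _) coprime2n.
rewrite dvdn_gcd order_dvdn -morphX // expgS expg1 xx1 morph1 eqxx /=.
by rewrite -card_quotient ?normal_norm // order_dvdG // mem_quotient.
Qed.

Lemma card_dihedral6 (gT : finGroupType) (x y : gT) :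
  #[x] = 3 -> #[y] = 2 -> x ^ y = x^-1 -> #|<[x]> <*> <[y]>| = 6.
Proof.
move=> ox oy xy; rewrite norm_joinEr; last first.
  by rewrite cycle_subG; apply/normP; rewrite -cycleJ xy cycleV.
by rewrite coprime_cardMg /= -?orderE ?ox ?oy.
Qed.

(** A transposition that computes on [nat], so that identities in ['S_6] can be decided point by
    point. *)
Definition swap_nat (i j n : nat) :=
  if n == i then j else if n == j then i else n.

Lemma val_transp6 i j (x : 'I_6) : (i < 6)%N -> (j < 6)%N ->
  val (transp6 i j x) = swap_nat i j (val x).
Proof.
move=> i6 j6; rewrite /transp6 permE /= /swap_nat -!val_eqE /= !inordK //.
by do 2 ![case: ifP => _; rewrite ?inordK //].
Qed.

Section F18_2.

Definition p135 : 'S_6 := transp6 1 3 * transp6 1 5.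
Definition p04_13 : 'S_6 := transp6 0 4 * transp6 1 3.
Definition p03_14_25 : 'S_6 := transp6 0 3 * transp6 1 4 * transp6 2 5.
Local Notation a := p135.
Local Notation b := p04_13.
Local Notation c := p03_14_25.

Ltac perm6 :=
  apply/permP => -[[|[|[|[|[|[|//]]]]]] ?]; apply/val_inj;
  by rewrite /p135 /p04_13 /p03_14_25 ?perm1 ?permM ?val_transp6.

(* a * (a ^ c)^-1, which c inverts. *)
Definition p135_042 : 'S_6 := p135 * p03_14_25 * p135 * p135 * p03_14_25.
Local Notation v := p135_042.

Ltac perm6v := rewrite /p135_042; perm6.

Lemma p135_rel : a * a * a = 1. Proof. perm6. Qed.
Lemma p04_13_rel : b * b = 1. Proof. perm6. Qed.
Lemma p03_14_25_rel : c * c = 1. Proof. perm6. Qed.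
Lemma p135_042_rel : v * v * v = 1. Proof. perm6v. Qed.
Lemma conj_a_b : a * b = b * a^-1.
(* Right multiplication by [a] clears the inverse and leaves products of transpositions to
   evaluate. *)
Proof. by apply: (mulIg a); rewrite mulgKV; perm6. Qed.
Lemma conj_v_a : v * a = a * v. Proof. perm6v. Qed.
Lemma conj_v_b : v * b = b * v^-1.
Proof. by apply: (mulIg v); rewrite mulgKV; perm6v. Qed.
Lemma conj_v_c : v * c = c * v^-1.
Proof. by apply: (mulIg v); rewrite mulgKV; perm6v. Qed.
Lemma conj_c_a : c * a = a * (c * v). Proof. perm6v. Qed.
Lemma conj_c_b : c * b = b * c. Proof. perm6. Qed.

Lemma perm6_neq1 (s : 'S_6) (x : 'I_6) : val (s x) != val x -> s != 1.
Proof. by apply: contraNneq => ->; rewrite perm1. Qed.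

Lemma order_p135 : #[a] = 3.
Proof.
apply: nt_prime_order => //; first by rewrite !expgS expg0 mulg1 mulgA p135_rel.
by apply: (@perm6_neq1 _ (@Ordinal 6 1 isT)); rewrite permM !val_transp6.
Qed.

Lemma order_p04_13 : #[b] = 2.
Proof.
apply: nt_prime_order => //; first by rewrite !expgS expg0 mulg1 p04_13_rel.
by apply: (@perm6_neq1 _ (@Ordinal 6 0 isT)); rewrite permM !val_transp6.
Qed.

Lemma order_p03_14_25 : #[c] = 2.
Proof.
apply: nt_prime_order => //; first by rewrite !expgS expg0 mulg1 p03_14_25_rel.
by apply: (@perm6_neq1 _ (@Ordinal 6 0 isT)); rewrite !permM !val_transp6.
Qed.

Lemma order_p135_042 : #[v] = 3.
Proof.
apply: nt_prime_order => //.
  by rewrite !expgS expg0 mulg1 mulgA p135_042_rel.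
by apply: (@perm6_neq1 _ (@Ordinal 6 0 isT)); rewrite !permM !val_transp6.
Qed.

Lemma conjg_of_commute (gT : finGroupType) (x y z : gT) :
  x * y = y * z -> x ^ y = z.
Proof. by move=> xy; apply: (mulgI y); rewrite -conjgC. Qed.

(** As [c] inverts [v], this is a copy of S_3; being transitive of order 6, it is regular. *)
Definition F18_2_regular : {group 'S_6} := (<[v]> <*> <[c]>)%G.
Local Notation S := F18_2_regular.
Canonical F18_2_group := Eval hnf in [group of F18_2].

Lemma card_F18_2_regular : #|S| = 6.
Proof.
exact: card_dihedral6 order_p135_042 order_p03_14_25
                      (conjg_of_commute conj_v_c).
Qed.

Lemma p135_042_in_regular : v \in S.
Proof. by rewrite mem_gen // inE cycle_id. Qed.
Lemma p03_14_25_in_regular : c \in S.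
Proof. by rewrite mem_gen // inE cycle_id orbT. Qed.

Lemma F18_2_regular_trans : [transitive S, on [set: 'I_6] | 'P].
Proof.
pose x0 : 'I_6 := @Ordinal 6 0 isT.
apply/imsetP; exists x0; rewrite ?inE //; apply/esym/setP => y; rewrite inE.
have orbS s : s \in S -> s x0 = y -> y \in orbit 'P S x0.
  by move=> Ss <-; exact: (mem_orbit 'P x0 Ss).
have [Sv Sc] := (p135_042_in_regular, p03_14_25_in_regular).
have Scv := groupM Sc Sv; have Svv := groupM Sv Sv.
case: y orbS => [[|[|[|[|[|[|//]]]]]] i6] orbS.
- by apply: (orbS _ (group1 S)); apply: val_inj; rewrite perm1.
- by apply: (orbS _ (groupM Scv Sv)); apply: val_inj;
    rewrite /p135_042 !permM !val_transp6.
- by apply: (orbS _ (Svv)); apply: val_inj;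
    rewrite /p135_042 !permM !val_transp6.
- by apply: (orbS _ (Sc)); apply: val_inj;
    rewrite /p135_042 !permM !val_transp6.
- by apply: (orbS _ (Sv)); apply: val_inj;
    rewrite /p135_042 !permM !val_transp6.
- by apply: (orbS _ (Scv)); apply: val_inj;
    rewrite /p135_042 !permM !val_transp6.
Qed.

Lemma F18_2_regular_free (x : 'I_6) : 'C_S[x | 'P] = 1.
Proof.
have := card_orbit_stab 'P S x; rewrite (atransP F18_2_regular_trans) ?inE //.
rewrite cardsT card_ord.
rewrite card_F18_2_regular => /eqP; rewrite -[X in _ == X]muln1 eqn_pmul2l //.
by move=> /eqP/card1_trivg.
Qed.

Lemma p135_in_F18_2 : a \in F18_2.
Proof. by rewrite mem_gen // !inE eqxx. Qed.
Lemma p04_13_in_F18_2 : b \in F18_2.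
Proof. by rewrite mem_gen // !inE eqxx orbT. Qed.
Lemma p03_14_25_in_F18_2 : c \in F18_2.
Proof. by rewrite mem_gen // !inE eqxx orbT. Qed.

Lemma F18_2_regular_normal : S <| F18_2.
Proof.
have [[Fa Fb] Fc] := (p135_in_F18_2, p04_13_in_F18_2, p03_14_25_in_F18_2).
apply/andP; split.
  rewrite join_subG !cycle_subG Fc andbT.
  exact: groupM (groupM (groupM (groupM Fa Fc) Fa) Fa) Fc.
have nS g : v ^ g \in S -> c ^ g \in S -> g \in 'N(S).
  by move=> Sv Sc; rewrite inE conjYg -!cycleJ join_subG !cycle_subG Sv.
have [Sv Sc] := (p135_042_in_regular, p03_14_25_in_regular).
rewrite /F18_2 gen_subG !subUset !sub1set -andbA; apply/and3P; split.
- by apply: nS; [rewrite (conjg_of_commute conj_v_a)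
                |rewrite (conjg_of_commute conj_c_a) groupM].
- by apply: nS; [rewrite (conjg_of_commute conj_v_b) groupV
                |rewrite (conjg_of_commute conj_c_b)].
- by apply: nS; [rewrite groupJ | rewrite groupJ].
Qed.

Lemma card_F18_2 : #|F18_2| = 36.
Proof.
pose T := (<[a]> <*> <[b]>)%G.
have cT : #|T| = 6 := card_dihedral6 order_p135 order_p04_13 (conjg_of_commute conj_a_b).
have [[Fa Fb] Fc] := (p135_in_F18_2, p04_13_in_F18_2, p03_14_25_in_F18_2).
have TF : T \subset F18_2 by rewrite join_subG !cycle_subG Fa.
have ST1 : S :&: T = 1.
  (* Both generators of [T] fix the point 2, whose stabiliser in [S] is trivial. *)
  pose x2 : 'I_6 := @Ordinal 6 2 isT.
  apply/trivgP; rewrite -(F18_2_regular_free x2) setIS // join_subG !cycle_subG.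
  by apply/andP; split; apply/astab1P; apply: val_inj;
    rewrite /= /aperm permM !val_transp6.
have -> : F18_2 = S * T.
  apply/eqP; rewrite eqEsubset mul_subG ?(normal_sub F18_2_regular_normal) // andbT.
  rewrite -norm_joinEr ?(subset_trans TF) ?(normal_norm F18_2_regular_normal) //.
  rewrite /F18_2 gen_subG !subUset !sub1set -andbA; apply/and3P; split.
  - exact: (subsetP (joing_subr S T) _ (subsetP (joing_subl _ _) _ (cycle_id a))).
  - exact: (subsetP (joing_subr S T) _ (subsetP (joing_subr _ _) _ (cycle_id b))).
  - exact: (subsetP (joing_subl S T) _ p03_14_25_in_regular).
by rewrite TI_cardMg // card_F18_2_regular cT.
Qed.

(** The involutions [b], [c] and [a * b] generate the group, and a normal subgroup of odd index
    contains them all. *)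
Lemma F18_2_no_normal_index3 (R : {group 'S_6}) : R <| F18_2 -> #|F18_2 : R| != 3.
Proof.
move=> nR; apply/eqP => iR.
have inv x : x \in F18_2 -> x * x = 1 -> x \in R.
  by apply: odd_index_involution nR _; rewrite iR.
have [[Fa Fb] Fc] := (p135_in_F18_2, p04_13_in_F18_2, p03_14_25_in_F18_2).
suff sFR : F18_2 \subset R by move: sFR; rewrite -indexg_eq1 iR.
have Rb : b \in R by apply: inv p04_13_rel.
have Rc : c \in R by apply: inv p03_14_25_rel.
rewrite /F18_2 gen_subG !subUset !sub1set -andbA; apply/and3P; split=> //.
rewrite -(groupMr _ Rb); apply: inv; first by rewrite groupM.
by rewrite mulgA conj_a_b mulgKV p04_13_rel.
Qed.

End F18_2.

(** * Translation action on cosets *)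

Lemma card_regular_perm_group (T : finType) (N : {group {perm T}}) (x : T) :
  regular_perm_group N -> #|N| = #|T|.
Proof.
case=> trN frN; rewrite -(card_orbit_stab 'P N x) frN cards1 muln1.
by rewrite (atransP trN) ?inE // cardsT.
Qed.

Section CosetPerm.
Variables (gT : finGroupType) (G H : {group gT}).
Hypothesis sHG : H \subset G.

Definition coset_type : predArgType := {X : {set gT} | X \in rcosets H G}.
Local Notation lambda := (actperm ('Rs^?)%act : gT -> {perm coset_type}).

Lemma coset_dom : G \subset subact_dom (fun X => X \in rcosets H G) 'Rs.
Proof.
suff E : [set X | X \in rcosets H G] = rcosets H G.
  by rewrite /subact_dom E; apply: actsRs_rcosets.
by apply/setP => X; rewrite inE.
Qed.

Lemma val_coset_lambda g (x : coset_type) : g \in G ->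
  val (lambda g x) = val x :* g.
Proof.
by move=> Gg; rewrite actpermE val_subact (subsetP coset_dom _ Gg) /= rcosetE.
Qed.

Fact mem_coset1 : gval H \in rcosets H G.
Proof. by apply/rcosetsP; exists 1; rewrite ?mulg1 ?group1. Qed.

Definition coset1 : coset_type := Sub (gval H) mem_coset1.

Lemma coset_typeP (x : coset_type) : exists2 g, g \in G & val x = H :* g.
Proof. by apply/rcosetsP/(valP x). Qed.

Lemma lambda_coset1 g : g \in G -> (lambda g coset1 == coset1) = (g \in H).
Proof.
move=> Gg; rewrite -val_eqE val_coset_lambda //=.
by apply/eqP/idP => [<- | /rcoset_id //]; rewrite rcoset_refl.
Qed.

Lemma card_coset_type : #|coset_type| = #|G : H|.
Proof. by rewrite card_sig. Qed.

Lemma coset_ker_sub : G :&: 'ker lambda \subset H.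
Proof.
apply/subsetP => g /setIP[Gg /mker g1].
by rewrite -lambda_coset1 // g1 perm1.
Qed.

Lemma coset_ker_normal : G :&: 'ker lambda <| G.
Proof.
rewrite /normal subsetIl normsI ?normG //.
by rewrite (subset_trans coset_dom) // ker_norm.
Qed.

(** [R] is transitive because G = H R makes every coset of the form H r. It is free because an r
    fixing H g has a conjugate in the intersection of [R] and [H]. *)
Lemma regular_normal_complement (R : {group gT}) :
  R <| G -> R :&: H = 1 -> (#|R| * #|H| = #|G|)%N ->
  exists N : {group {perm coset_type}},
    [/\ N \subset lambda @* G, regular_perm_group N & lambda @* G \subset 'N(N)].
Proof.
move=> nRG RH1 cRH; have sRG := normal_sub nRG.
have GE : H * R = G.
  apply/eqP; rewrite eqEcard mul_subG // TI_cardMg 1?setIC //.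
  by rewrite mulnC cRH leqnn.
have lamN : lambda @* R \subset lambda @* G := morphimS _ sRG.
exists (lambda @* R)%G; split=> //; last exact: morphim_norms (normal_norm nRG).
split=> [|x].
  apply/imsetP; exists coset1; rewrite ?inE //; apply/esym/setP => y.
  rewrite inE; have [h Gh yh] := coset_typeP y.
  have [k r Hk Rr hE] : imset2_spec mulg (mem H) (fun=> mem R) h.
    by apply/mulsgP; rewrite GE.
  move: yh; rewrite {h Gh}hE => yh.
  have Gr := subsetP sRG r Rr.
  suff -> : y = lambda r coset1.
    by apply: mem_orbit; rewrite mem_morphim ?(subsetP coset_dom).
  by apply: val_inj; rewrite val_coset_lambda // yh /= rcosetM rcoset_id.
apply/trivgP/subsetP => s /setIP[/morphimP[r Dr Rr ->] /astab1P /= fx].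
have Gr := subsetP sRG r Rr; have [g Gg xg] := coset_typeP x.
move/(congr1 val): fx; rewrite /aperm val_coset_lambda // xg -rcosetM => Hgr.
have : r ^ g^-1 \in R :&: H.
  rewrite inE memJ_norm ?groupV ?(subsetP (normal_norm nRG)) // Rr /=.
  rewrite conjgE invgK mulgA -mem_rcoset -Hgr; exact: rcoset_refl.
rewrite RH1 => /set1gP/eqP; rewrite conjg_eq1 => /eqP->.
by rewrite morph1 group1.
Qed.

Hypothesis ker1 : G :&: 'ker lambda = 1.

Lemma coset_restrm_injm : 'injm (restrm coset_dom lambda).
Proof. by rewrite ker_restrm ker1. Qed.

Lemma coset_restrm_im : restrm coset_dom lambda @* G = lambda @* G.
Proof. by rewrite morphim_restrm setIid. Qed.

(** The action of [G] is faithful, so the preimage of [N] has order |N| = |G : H|, hence index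
    |H|. *)
Lemma regular_normal_preimage :
  (exists N : {group {perm coset_type}},
    [/\ N \subset lambda @* G, regular_perm_group N & lambda @* G \subset 'N(N)]) ->
  exists2 R : {group gT}, R <| G & #|G : R| = #|H|.
Proof.
case=> N [sN regN nN]; rewrite -coset_restrm_im in sN nN.
exists (restrm coset_dom lambda @*^-1 N)%G.
  rewrite /normal subsetIl /=; apply: subset_trans (morphpre_norms _ nN).
  by rewrite -sub_morphim_pre.
have cR : #|restrm coset_dom lambda @*^-1 N| = #|G : H|.
  rewrite -card_coset_type -(card_regular_perm_group coset1 regN).
  by rewrite -{2}(morphpreK sN) (card_injm coset_restrm_injm) ?subsetIl.
apply/eqP; rewrite -(eqn_pmul2l (cardG_gt0 (restrm coset_dom lambda @*^-1 N)%G)).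
by rewrite Lagrange ?subsetIl // [X in (X * _)%N]cR mulnC Lagrange.
Qed.

End CosetPerm.

(** * Transport along a permutation isomorphism *)

Section PermTransport.
Variables (T U : finType) (f : T -> U) (g : U -> T).
Hypotheses (fK : cancel f g) (gK : cancel g f).

Fact perm_transport_inj (s : {perm T}) : injective (f \o s \o g).
Proof.
by apply: inj_comp; [apply: inj_comp; [exact: can_inj fK | exact: perm_inj]
                    | exact: can_inj gK].
Qed.

Definition perm_transport s := perm (@perm_transport_inj s).

Lemma perm_transportE s x : perm_transport s (f x) = f (s x).
Proof. by rewrite permE /= fK. Qed.

Fact perm_transportM :
  {in [set: {perm T}] &, {morph perm_transport : s t / s * t}}.
Proof.
move=> s t _ _; apply/permP => u; rewrite -(gK u) permM !perm_transportE.
by rewrite permM.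
Qed.

Canonical perm_transport_morphism := Morphism perm_transportM.

Lemma perm_transport_injm : 'injm perm_transport_morphism.
Proof.
apply/subsetP => s /mker /= s1; rewrite inE; apply/eqP/permP => x.
by apply: (can_inj fK); rewrite -perm_transportE s1 !perm1.
Qed.

End PermTransport.

Lemma F18_2_transport (T : finType) (A : {group {perm T}}) :
  perm_isomorphic A F18_2 ->
  [/\ #|T| = 6, #|A| = 36,
      exists S : {group {perm T}},
        [/\ S <| A, #|S| = 6 & forall x, 'C_S[x | 'P] = 1] &
      forall R : {group {perm T}}, R <| A -> #|A : R| != 3].
Proof.
case=> f [g fK gK] fA; pose h := perm_transport_morphism fK gK.
have injh : 'injm h := perm_transport_injm fK gK.
have hE s x : h s (f x) = f (s x) := perm_transportE fK gK s x.
have hA : h @* A = F18_2.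
  apply/setP => t; apply/idP/idP => [/morphimP[s _ /fA[t' Ft' st'] ->]|Ft].
    suff -> : h s = t' by [].
    by apply/permP => u; rewrite -(gK u) hE st'.
  pose s := perm_transport gK fK t.
  have st x : f (s x) = t (f x) by rewrite permE /= gK.
  suff <- : h s = t by rewrite mem_morphim ?inE //; apply/fA; exists t.
  by apply/permP => u; rewrite -(gK u) hE st.
have sub (R : {set {perm T}}) : R \subset 'dom h by rewrite subsetT.
split.
- by rewrite (bij_eq_card (Bijective fK gK)) card_ord.
- by rewrite -(card_injm injh (sub A)) hA card_F18_2.
- exists (h @*^-1 F18_2_regular)%G; have nS := F18_2_regular_normal.
  have sS : F18_2_regular \subset h @* A by rewrite hA normal_sub.
  have SE : h @* (h @*^-1 F18_2_regular) = F18_2_regular.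
    by apply: morphpreK; apply: subset_trans sS (morphimS _ (sub A)).
  split.
  + by rewrite -(injm_normal injh) ?sub // SE hA.
  + by rewrite -(card_injm injh (sub _)) SE card_F18_2_regular.
  move=> x; apply/trivgP/subsetP => s /setIP[/morphpreP[_ Shs] /astab1P sx].
  rewrite inE -(morph_injm_eq1 injh) ?inE //.
  apply/eqP/set1gP; rewrite -(F18_2_regular_free (f x)) inE Shs.
  by apply/astab1P; rewrite /= /aperm hE; congr f.
move=> R nR; have sRA := normal_sub nR.
have nhR : (h @* R)%G <| F18_2 by rewrite -hA injm_normal ?sub.
move: (F18_2_no_normal_index3 nhR).
by rewrite -!divgS ?normal_sub //= -hA !(card_injm injh) ?sub.
Qed.

Lemma coset_F18_2 (gT : finGroupType) (G H : {group gT}) :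
  H \subset G ->
  let lambda := (actperm ('Rs^?)%act : gT -> {perm coset_type G H}) in
  G :&: 'ker lambda = 1 -> perm_isomorphic (lambda @* G) F18_2 ->
  [/\ #|G| = 36, #|H| = 6,
      exists S : {group gT}, [/\ S <| G, #|S| = 6 & S :&: H = 1] &
      forall R : {group gT}, R <| G -> #|G : R| != 3].
Proof.
move=> sHG lambda ker1 isoG; pose h := restrm (coset_dom G H) lambda.
have injh : 'injm h := coset_restrm_injm ker1.
have hG : h @* G = lambda @* G := coset_restrm_im G H.
have [cT cA [S [nS cS frS]] noA] := F18_2_transport isoG.
have cG : #|G| = 36 by rewrite -cA /= -hG card_injm.
have sS : S \subset h @* G by rewrite hG normal_sub.
split=> //.
- move: (Lagrange sHG); rewrite -card_coset_type cT cG => /eqP.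
  by rewrite -[36]/(6 * 6)%N eqn_pmul2r // => /eqP.
- exists (h @*^-1 S)%G; split.
  + by rewrite -(injm_normal injh) ?subsetIl // morphpreK // hG.
  + by rewrite -(card_injm injh) ?subsetIl // morphpreK.
  apply/trivgP/subsetP => g /setIP[/morphpreP[Gg Shg] Hg].
  rewrite inE -(morph_injm_eq1 injh) //.
  (* An element of [H] fixes the base coset, where [S] acts freely. *)
  apply/eqP/set1gP; rewrite -(frS (coset1 G H)) inE Shg.
  by apply/astab1P/eqP; rewrite /= /aperm lambda_coset1.
move=> R nR; have sRG := normal_sub nR.
have nhR : (h @* R)%G <| lambda @* G by rewrite -hG injm_normal.
move: (noA _ nhR).
by rewrite -!divgS ?normal_sub //= -hG !(card_injm injh).
Qed.

Local Close Scope group_scope.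

(** * The field extension F/k *)

Section GalEmbed.
Local Open Scope ring_scope.
Variables (k : fieldType) (M : splittingFieldType k) (E : {subfield M}).

Lemma gal_full (g : gal_of E) : g \in 'Gal(E / 1)%g.
Proof. by rewrite gal_kHom ?sub1v // k1AHom. Qed.

Variables (L : {subfield M}) (sLE : (L <= E)%VS) (g : gal_of E).

Definition gal_embed (x : subvs_of L) : subvs_of E :=
  Subvs (memv_gal g (subvP sLE _ (subvsP x))).

Fact gal_embed_is_linear : linear gal_embed.
Proof. by move=> a x y; apply: val_inj; rewrite /= !linearP. Qed.

Fact gal_embed_is_monoid_morphism : monoid_morphism gal_embed.
Proof.
split=> [|x y]; apply: val_inj; last by rewrite /= rmorphM.
by rewrite /= algid1 rmorph1 algid1.
Qed.

HB.instance Definition _ := GRing.isLinear.Build k (subvs_of L) (subvs_of E) _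
  gal_embed gal_embed_is_linear.
HB.instance Definition _ := GRing.isMonoidMorphism.Build (subvs_of L)
  (subvs_of E) gal_embed gal_embed_is_monoid_morphism.

End GalEmbed.

(** * Left translations by S and right translations by B *)

Section SplitHopfGalois.
Local Open Scope ring_scope.
Variables (k : fieldType) (M : splittingFieldType k) (E F : {subfield M}).
Hypotheses (galE : galois 1 E) (sFE : (F <= E)%VS).
Local Notation G := ('Gal(E / 1))%g.
Local Notation Q := ('Gal(E / F))%g.
Variables S B : {group gal_of E}.
Hypothesis nSG : (S <| G)%g.
Hypothesis nBQ : (B \subset 'N(Q))%g.
Hypothesis abB : abelian B.
Hypothesis QB1 : (Q :&: B = 1)%g.
Hypothesis SQB1 : (S :&: Q * B \subset [1])%g.
Hypothesis cardSB : (#|S| * #|B| = \dim F)%N.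

Let N : finGroupType := ([subg S] * [subg B])%type.

Fact conj_subgP (g : gal_of E) (s : [subg S]) : (sgval s ^ g \in S)%g.
Proof.
by rewrite memJ_norm ?subgP // (subsetP (normal_norm nSG)) ?gal_full.
Qed.

(** Left translations commute with the right translations by [B], so conjugation moves only the
    component in [S]. *)
Definition split_act (g : gal_of E) (n : N) : N :=
  (subg S (sgval n.1 ^ g)%g, n.2).

Definition split_rep (n : N) : gal_of E := (sgval n.2 * sgval n.1)%g.

Lemma fixed_by_Q (q g : gal_of E) x : q \in Q -> x \in F ->
  (q * g)%g x = g x.
Proof.
by move=> Qq Fx; rewrite galM ?(subvP sFE) // (fixed_gal sFE Qq Fx).
Qed.

Lemma eq_on_F (g h : gal_of E) : {in F, g =1 h} -> (g * h^-1)%g \in Q.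
Proof.
move=> gh; rewrite gal_kHom //; apply/kAHomP => x Fx.
have Ex := subvP sFE x Fx.
by rewrite galM // gh // -galM // mulgV gal_id.
Qed.

Lemma split_hopf_galois : hopf_galois (subvs_of F).
Proof.
pose sigma (g : gal_of E) : {lrmorphism subvs_of E -> subvs_of E} :=
  gal_embed (subvv E) g.
pose e (n : N) : {lrmorphism subvs_of F -> subvs_of E} :=
  gal_embed sFE (split_rep n).
apply: (@descent_hopf_galois k (subvs_of F) (subvs_of E) (gal_of E) N sigma
          split_act e).
- by move=> g h x; apply: val_inj; rewrite /= galM ?subvsP.
- move=> g h gh; apply/eqP/gal_eqP => x Ex.
  by have := congr1 vsval (gh (Subvs Ex)).
- move=> x fx.
  suff : vsval x \in 1%VS.
    case/vlineP => a xa; apply/vlineP; exists a; apply: val_inj.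
    by rewrite /= xa algid1.
  have /galois_fixedField <- := galE; apply/fixedFieldP => [|g _].
    exact: subvsP.
  by have := congr1 vsval (fx g).
- by case=> s b; rewrite /split_act /= conjg1 sgvalK.
- by move=> g h [s b]; rewrite /split_act /= conjgM subgK ?conj_subgP.
- move=> g [s b] [t d]; congr (_, _); apply: val_inj => /=.
  have [Ss St] := (conj_subgP g s, conj_subgP g t).
  by rewrite conjMg !subgK //; apply: groupM.
- move=> [s b] [t d] est.
  have Qst : (split_rep (s, b) * (split_rep (t, d))^-1)%g \in Q.
    by apply: eq_on_F => x Fx; have := congr1 vsval (est (Subvs Fx)).
  pose u := (sgval s * (sgval t)^-1)%g.
  pose w := (sgval b * (sgval d)^-1)%g.
  have Bw : w \in B by rewrite groupM ?groupV ?subgP.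
  have Suw : (u ^ (sgval b)^-1)%g \in S.
    rewrite memJ_norm ?groupM ?groupV ?subgP //.
    by rewrite (subsetP (normal_norm nSG)) ?groupV ?gal_full.
  (* Regroup b s (d t)^-1, an element of [Q], as a conjugate of s t^-1 lying in [S] times b d^-1 in
     [B]; the two intersection hypotheses then kill both factors. *)
  have Quw : (u ^ (sgval b)^-1 * w)%g \in Q.
    move: Qst; rewrite /split_rep /u /w /= invMg conjgE invgK !mulgA.
    by rewrite mulgKV.
  have u1 : (u ^ (sgval b)^-1)%g = 1%g.
    apply/set1gP; apply: (subsetP SQB1); rewrite inE Suw /= -(mulgK w (_ ^ _)%g).
    by rewrite mem_mulg // groupV.
  have w1 : w = 1%g.
    by apply/set1gP; rewrite -QB1 inE Bw andbT -[w]mul1g -u1.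
  move/eqP: u1; rewrite conjg_eq1 => /eqP u1.
  congr (_, _); apply: val_inj; apply/eqP; rewrite eq_mulgV1 /=.
    by apply/eqP.
  by apply/eqP.
- move=> n; exists (split_rep n) => x; apply: val_inj.
  by rewrite /= /split_rep /= mulg1 gal_id.
- move=> g [s b] eg [t d] x; apply: val_inj => /=.
  have Ex := subvP sFE _ (subvsP x).
  have Qq : (g * (split_rep (s, b))^-1)%g \in Q.
    apply: eq_on_F => y Fy; have := congr1 vsval (eg (Subvs Fy)).
    by rewrite /= /split_rep mulg1 gal_id.
  rewrite -galM // /split_rep /= subgK ?conj_subgP //.
  (* With g = q b s, q in [Q], one has d t g = d q b s t^g = q' (b d) (s t^g), where q' = d q d^-1
     is in [Q] since [B] normalises [Q], and b d = d b. *)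
  have Qqd : ((g * (split_rep (s, b))^-1) ^ (sgval d)^-1)%g \in Q.
    by rewrite memJ_norm // groupV (subsetP nBQ) ?subgP.
  rewrite -[RHS](fixed_by_Q _ Qqd (subvsP x)); congr (gal_repr _ _).
  rewrite -(centsP abB _ (subgP d) _ (subgP b)) /split_rep /= !conjgE invgK invMg.
  rewrite !mulgA.
  by rewrite !mulgKV mulgK.
- move=> y fy.
  suff Fy : vsval y \in F.
    by exists (Subvs Fy); apply: val_inj; rewrite /= /split_rep mulg1 gal_id.
  have /galois_fixedField <- : galois F E by apply: galoisS galE; rewrite sub1v.
  apply/fixedFieldP => [|g Qg]; first exact: subvsP.
  suff fg : sigma g y = y by have := congr1 vsval fg.
  apply: fy => x; apply: val_inj.
  by rewrite /= /split_rep mulg1 gal_id (fixed_gal sFE Qg) ?subvsP.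
rewrite card_prod !card_sub dimvf -[RHS]/(\dim F) -cardSB; congr (_ * _)%N.
Qed.

End SplitHopfGalois.

(** * Galois closures and the two degrees *)

Lemma galois_closure_core (k : fieldType) (M : splittingFieldType k)
    (K E : {subfield M}) (Z : {group gal_of E}) :
  galois_closure K E -> (Z <| 'Gal(E / 1))%g -> Z \subset 'Gal(E / K)%g ->
  Z :=: 1%g.
Proof.
case=> sKE galE minE nZ; rewrite galois_connection // => sKZ.
(* The fixed field of a normal subgroup is Galois over the base; it contains [K], so by minimality
   it contains [E]. *)
have sEZ := minE [aspace of fixedField Z] sKZ (normal_fixedField_galois galE nZ).
apply/trivgP/subsetP => z Zz; rewrite inE; apply/gal_eqP => x Ex.
by rewrite gal_id; have [_ ->] := mem_fixedFieldP (subvP sEZ x Ex).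
Qed.

Lemma galois_closure_uniq (k : fieldType) (M : splittingFieldType k)
    (L E E' : {subfield M}) :
  galois_closure L E -> galois_closure L E' -> E = E'.
Proof.
case=> sLE galE minE [sLE' galE' minE']; apply/val_inj/eqP.
by rewrite eqEsubv minE // minE'.
Qed.

Lemma card_gal_dim (k : fieldType) (M : splittingFieldType k)
    (L E : {subfield M}) :
  galois 1 E -> (L <= E)%VS -> (#|'Gal(E / L)%g| * \dim L = \dim E)%N.
Proof.
move=> galE sLE; rewrite -galois_dim ?divnK ?field_dimS //.
by apply: galoisS galE; rewrite sub1v.
Qed.

Theorem proposition4p4 (k : fieldType) (M : splittingFieldType k)
    (K Kt F : {subfield M}) :
  \dim K = 6 ->
  separable 1%VS K ->
  galois_closure K Kt ->
  perm_isomorphic (gal_lambda Kt K) F18_2 ->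
  (K <= F <= Kt)%VS ->
  (\dim F = 18 -> almost_classically_galois F) /\
  (\dim F = 12 ->
     hopf_galois (subvs_of F) /\ ~ almost_classically_galois F).
Proof.
move=> _ _ cloK isoK /andP[sKF sFKt]; have [sKKt galKt minKt] := cloK.
pose G := 'Gal(Kt / 1)%G; pose D := 'Gal(Kt / K)%G; pose Q := 'Gal(Kt / F)%G.
have sQD : Q \subset D by apply: galS.
have sDG : D \subset G by apply: galS; rewrite sub1v.
have sQG := subset_trans sQD sDG.
have core (Z : {group gal_of Kt}) : (Z <| G)%g -> Z \subset D -> Z :=: 1%g.
  exact: galois_closure_core.
have ker1 (H : {group gal_of Kt}) : H \subset D ->
    (G :&: 'ker (actperm ('Rs^?)%act : gal_of Kt -> {perm coset_type G H})
     = 1)%g.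
  move=> sHD; apply: core (coset_ker_normal G H) _.
  exact: subset_trans (coset_ker_sub G H) sHD.
have [cG cD [S [nSG cS SD1]] noG3] := coset_F18_2 sDG (ker1 D (subxx _)) isoK.
have cloF : galois_closure F Kt.
  by split=> // E' /(subv_trans sKF); apply: minKt.
have cQ : (#|Q| * \dim F = 36)%N.
  rewrite card_gal_dim // -cG -(card_gal_dim galKt (sub1v _)).
  by rewrite dimv1 muln1.
have SDG : (S * D)%g = G.
  apply/eqP; rewrite eqEcard mul_subG ?(normal_sub nSG) //=.
  by rewrite TI_cardMg // cS cD cG.
split=> dF; move: cQ; rewrite dF.
  rewrite -[36]/(2 * 18)%N => /eqP; rewrite eqn_pmul2r // => /eqP cQ.
  have [A sylA] := Sylow_exists 3 D.
  have [sAD cA] : A \subset D /\ #|A| = 3.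
    by split; [exact: pHall_sub sylA | rewrite (card_Hall sylA) p_part cD].
  have nAD : (A <| D)%g by apply: index2_normal => //; rewrite -divgS // cD cA.
  have nSD := subset_trans sDG (normal_norm nSG).
  have RE : (S <*> A)%g = (S * A)%g by rewrite norm_joinEr ?(subset_trans sAD).
  have SA1 : (S :&: A = 1)%g by apply/trivgP; rewrite -SD1 setIS.
  (* As G = S D, it suffices that S A is normalised by itself and by [D]. *)
  have nRG : (S <*> A <| G)%g.
    rewrite /normal join_subG (normal_sub nSG) (subset_trans sAD sDG) /=.
    rewrite -{1}SDG; apply: mul_subG; last by rewrite normsY ?(normal_norm nAD).
    exact: subset_trans (joing_subl S A) (normG (S <*> A)%G).
  have RQ1 : ((S <*> A) :&: Q = 1)%g.
    (* If s a lies in [Q], hence in [D], then s lies in both [S] and [D], so s = 1; and [A] meets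
       [Q] trivially, their orders being 3 and 2. *)
    apply/trivgP; rewrite /= RE.
    apply/subsetP => q /setIP[/mulsgP[s a Ss Aa ->] Qsa].
    have Da := subsetP sAD a Aa.
    have s1 : s = 1%g.
      by apply/set1gP; rewrite -SD1 inE Ss -(groupMr _ Da) (subsetP sQD).
    have AQ1 : (A :&: Q = 1)%g by apply: coprime_TIg; rewrite cA cQ.
    by rewrite -AQ1 inE s1 mul1g Aa; rewrite s1 mul1g in Qsa.
  exists Kt => //; apply: (regular_normal_complement sQG nRG RQ1).
  by rewrite /= RE TI_cardMg // cS cA cQ cG.
rewrite -[36]/(3 * 12)%N => /eqP; rewrite eqn_pmul2r // => /eqP cQ; split.
  have [B sylB] := Sylow_exists 2 D.
  have [sBD cB] : B \subset D /\ #|B| = 2.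
    by split; [exact: pHall_sub sylB | rewrite (card_Hall sylB) p_part cD].
  have nQD : (Q <| D)%g by apply: index2_normal => //; rewrite -divgS // cD cQ.
  apply: (split_hopf_galois galKt sFKt nSG (B := B)).
  - exact: subset_trans sBD (normal_norm nQD).
  - by rewrite cyclic_abelian // prime_cyclic // cB.
  - by apply: coprime_TIg; rewrite cQ cB.
  - by rewrite -SD1 setIS // mul_subG.
  - by rewrite cS cB dF.
case=> E cloE; rewrite (galois_closure_uniq cloE cloF).
(* A regular normalised subgroup would yield a normal subgroup of index |Q| = 3. *)
case/(regular_normal_preimage sQG (ker1 Q sQD)) => R nRG.
by rewrite cQ; apply/eqP/noG3.
Qed.
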